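(* Suppose that the $\mathbb{R}$-valued resampling mechanism described in the context is given; in particular, $\boldsymbol S_n$ converges weakly to a random variable $\boldsymbol S$ with continuous distribution function $F$. Suppose moreover that one of the equivalent bootstrap consistency assertions (a)–(f) listed in the context holds. Then, for any $\alpha\in(0,1)$, $$\lim_{n\to\infty}\mathbb{P}\{\boldsymbol S_n\ge(F_n)^{-1}(1-\alpha)\}=\alpha\quad\text{and}\quad\lim_{n,M\to\infty}\mathbb{P}\{\boldsymbol S_n\ge(F_n^M)^{-1}(1-\alpha)\}=\alpha.$$ The statements with ''$\ge$'' replaced by ''$>$'' in the previous display hold as well.
   Context: Resampling mechanism. $(\Omega,\mathcal{A},\mathbb{P})$ is a probability space. For $n\in\mathbb{N}$, $\boldsymbol X_n:\Omega\to\mathcal{X}_n$ is a random variable in some measurable space $\mathcal{X}_n$ (the data), and $\boldsymbol S_n=\boldsymbol S_n(\boldsymbol X_n)$ is a real-valued statistic. Moreover, $\boldsymbol W_n^{(i)}:\Omega\to\mathcal{W}_n$, $i\in\mathbb{N}$, are identically distributed random variables in some measurable space $\mathcal{W}_n$, and $\boldsymbol S_n^{(i)}=\boldsymbol S_n^{(i)}(\boldsymbol X_n,\boldsymbol W_n^{(i)})$, $i\in\mathbb{N}$, are real-valued statistics (to be considered as bootstrap replicates of $\boldsymbol S_n$) that are independent conditionally on $\boldsymbol X_n$. It is assumed that $\mathbb{P}(\boldsymbol S_n^{(1)}\in\cdot\mid\boldsymbol X_n)$ has a regular version, denoted $\mathbb{P}^{\boldsymbol S_n^{(1)}\mid\boldsymbol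 X_n}$, the regular conditional distribution of $\boldsymbol S_n^{(1)}$ given $\boldsymbol X_n$. Additionally, $\boldsymbol S_n$ converges weakly, as $n\to\infty$, to a random variable $\boldsymbol S$ with continuous distribution function $F$. Notation. For $n,M\in\mathbb{N}$, $x\in\mathbb{R}$: $F_n^M(x)=\frac1M\sum_{i=1}^M\mathbf{1}(\boldsymbol S_n^{(i)}\le x)$, $F_n(x)=\mathbb{P}(\boldsymbol S_n^{(1)}\le x\mid\boldsymbol X_n)$, $F(x)=\mathbb{P}(\boldsymbol S\le x)$. For a distribution function $G$, $G^{-1}$ is its generalized inverse, $G^{-1}(y)=\inf\{x\in\mathbb{R}:G(x)\ge y\}$, $y\in(0,1]$. $\mathbb{P}^Y$ is the law of $Y$, $\leadsto$ is weak convergence, $\hat{\mathbb{P}}_M^{\boldsymbol S_n}=\frac1M\sum_{i=1}^M\delta_{\boldsymbol S_n^{(i)}}$. For probability measures $P,Q$ on $\mathbb{R}$, $d_{\mathrm{BL}}(P,Q)=\sup_f|\int f\,dP-\int f\,dQ|$, the supremum being over $f:\mathbb{R}\to[-1,1]$ with $|f(x)-f(y)|\le|x-y|$ for all $x,y$, and $d_K(P,Q)=\sup_{x\in\mathbb{R}}|P\{(-\infty,x]\}-Q\{(-\infty,x]\}|$. Limits ''as $n,M\to\infty$'' are limits of nets indexed by $(n,M)\in\mathbb{N}^2$, both indices tending to infinity. Bootstrap consistency assertions (equivalent to one another in this setting): (a) $\mathbb{P}^{(\boldsymbol S_n,\boldsymbol S_n^{(1)},\boldsymbol S_n^{(2)})}\leadsto(\mathbb{P}^{\boldsymbol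 S})^{\otimes 3}$ as $n\to\infty$; (b) $\mathbb{P}^{(\boldsymbol S_n,\boldsymbol S_n^{(1)},\dots,\boldsymbol S_n^{(M)})}\leadsto(\mathbb{P}^{\boldsymbol S})^{\otimes(M+1)}$ as $n\to\infty$, for any $M\ge2$; (c) $d_{\mathrm{BL}}(\mathbb{P}^{\boldsymbol S_n^{(1)}\mid\boldsymbol X_n},\mathbb{P}^{\boldsymbol S_n})\to0$ in probability as $n\to\infty$; (d) $d_{\mathrm{BL}}(\hat{\mathbb{P}}_M^{\boldsymbol S_n},\mathbb{P}^{\boldsymbol S_n})\to0$ in probability as $n,M\to\infty$; (e) $d_K(\mathbb{P}^{\boldsymbol S_n^{(1)}\mid\boldsymbol X_n},\mathbb{P}^{\boldsymbol S_n})\to0$ in probability as $n\to\infty$; (f) $d_K(\hat{\mathbb{P}}_M^{\boldsymbol S_n},\mathbb{P}^{\boldsymbol S_n})\to0$ in probability as $n,M\to\infty$.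
   Formalization: The replicates S_n^(i), i in N, are additionally assumed to be identically distributed conditionally on X_n; identically distributed W_n^(i) alone do not suffice (e.g. S_n = X_n uniform, W_n^(1) an independent copy, W_n^(i) = X_n for i ≥ 2). *)

(* Defs.v *)
From HB Require Import structures.
From mathcomp Require Import all_boot all_order all_algebra finmap.
From mathcomp Require Import all_classical all_reals all_analysis.

Set Implicit Arguments.
Unset Strict Implicit.
Unset Printing Implicit Defensive.

Import Order.TTheory GRing.Theory Num.Theory.
Import numFieldNormedType.Exports.

Local Open Scope classical_set_scope.
Local Open Scope ring_scope.

Section conditioning.
Context {d dX : measure_display} {Omega : measurableType d}
  {XX : measurableType dX} {R : realType} (P : probability Omega R).
Variable X : {RV P >-> XX}.

(* [g] is a version of the conditional probability of [E] given [X], written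
   as a function on the range space of [X], i.e. P(E | X) = g(X) a.s.
   (Doob-Dynkin: every sigma(X)-measurable version has this form). *)
Definition is_cond_prob (E : set Omega) (g : XX -> R) : Prop :=
  (distribution P X).-integrable setT (EFin \o g) /\
  forall A : set XX, measurable A ->
    (\int[distribution P X]_(x in A) (g x)%:E = P (E `&` X @^-1` A))%E.

Definition is_regular_cond_dist (Y : {RV P >-> R}) (K : R.-pker XX ~> R)
    : Prop :=
  forall B : set R, measurable B ->
    is_cond_prob (Y @^-1` B) (fun x => fine (K x B)).

Definition cond_independent (Y : nat -> {RV P >-> R}) : Prop :=
  forall (J : {fset nat}) (B : nat -> set R) (g : nat -> XX -> R),
    (forall i, measurable (B i)) ->
    (forall i, is_cond_prob (Y i @^-1` B i) (g i)) ->
    is_cond_prob (\bigcap_(i in [set` J]) (Y i @^-1` B i))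
      (fun x => \prod_(i <- J) g i x).

(* Common conditional law given [X].  It does not follow from a common marginal
   law of the resampling variables W^(i) alone: with X uniform, W^(1) an
   independent copy of X and W^(2) = X, the laws of W^(1) and W^(2) agree but
   their conditional laws given X differ. *)
Definition cond_identically_distributed (Y : nat -> {RV P >-> R}) : Prop :=
  forall (i j : nat) (B : set R) (g : XX -> R), measurable B ->
    is_cond_prob (Y i @^-1` B) g -> is_cond_prob (Y j @^-1` B) g.

End conditioning.

Definition identically_distributed {d dW : measure_display}
    {Omega : measurableType d} {WW : measurableType dW} {R : realType}
    (P : probability Omega R) (W : nat -> {RV P >-> WW}) : Prop :=
  forall (i j : nat) (A : set WW), measurable A ->
    distribution P (W i) A = distribution P (W j) A.

Section weak_convergence.
Context {R : realType}.

Definition weak_cvg (mu : nat -> set R -> \bar R) (nu : set R -> \bar R)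
    : Prop :=
  forall f : R -> R, continuous f -> bounded_fun f ->
    (\int[mu n]_x (f x)%:E)%E @[n --> \oo] --> (\int[nu]_x (f x)%:E)%E.

(* The library has a sigma-algebra on [m.-tuple R] but no topology, and a
   topology on ['rV[R]_m] but no sigma-algebra; both are R^m. *)
Definition weak_cvg_tuple (m : nat) (mu : nat -> set (m.-tuple R) -> \bar R)
    (nu : set (m.-tuple R) -> \bar R) : Prop :=
  forall f : 'rV[R]_m -> R, continuous f -> bounded_fun f ->
    (\int[mu n]_t (f (\row_i tnth t i))%:E)%E @[n --> \oo]
      --> (\int[nu]_t (f (\row_i tnth t i))%:E)%E.

Definition cons_pair (m : nat) (u : R * m.-tuple R) : m.+1.-tuple R :=
  [the m.+1.-tuple R of u.1 :: u.2].

Lemma measurable_cons_pair (m : nat) : measurable_fun setT (@cons_pair m).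
Proof. exact: measurable_cons. Qed.

HB.instance Definition _ (m : nat) :=
  isMeasurableFun.Build _ _ _ _ (@cons_pair m) (@measurable_cons_pair m).

Fixpoint tensor_power (mu : probability R R) (m : nat)
    : probability (m.-tuple R) R :=
  match m with
  | 0 => \d_([tuple])
  | m'.+1 => distribution (mu \x tensor_power mu m')%E (@cons_pair m')
  end.

End weak_convergence.

Definition cvg_in_prob0 {d : measure_display} {Omega : measurableType d}
    {R : realType} (P : probability Omega R) {I : Type} (F : set_system I)
    (Y : I -> Omega -> \bar R) : Prop :=
  forall eps : R, 0 < eps ->
    P [set w | (eps%:E < `|Y i w|)%E] @[i --> F] --> 0%E.

Section distances.
Context {R : realType}.
Local Open Scope ereal_scope.

Definition BL1 : set (R -> R) :=
  [set f | (forall x, `|f x| <= 1)%R /\ (forall x y, `|f x - f y| <= `|x - y|)%R].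

Definition dBL (p q : set R -> \bar R) : \bar R :=
  ereal_sup [set `| \int[p]_x (f x)%:E - \int[q]_x (f x)%:E | | f in BL1].

Definition dK (p q : set R -> \bar R) : \bar R :=
  ereal_sup [set `| p `]-oo, x]%classic - q `]-oo, x]%classic | | x in [set: R]].

Definition empirical (y : nat -> R) (M : nat) : set R -> \bar R :=
  mscale ((M%:R^-1 : R)%:nng)%R (msum (fun i => \d_(y i)) M).

End distances.

(* [empirical y 0] and [emp_df y 0] are zero; limits in M ignore M = 0. *)
Definition emp_df {R : realType} (y : nat -> R) (M : nat) (x : R) : R :=
  M%:R^-1 * \sum_(i < M) (y i <= x)%R%:R.

Definition ker_df {dX : measure_display} {XX : measurableType dX}
    {R : realType} (K : R.-pker XX ~> R) (z : XX) (x : R) : R :=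
  fine (K z `]-oo, x]%classic).

(* [inf] is a junk value on an empty or unbounded set; neither occurs when [G]
   is a distribution function and 0 < y < 1. *)
Definition gen_inv {R : realType} (G : R -> R) (y : R) : R :=
  inf [set x | y <= G x].

(* Replicates are numbered from 0: [Sb n 0], [Sb n 1], ... stand for
   S_n^(1), S_n^(2), ... *)
Section consistency.
Context {d dS : measure_display} {Omega : measurableType d}
  {OmegaS : measurableType dS} {R : realType}.
Variables (P : probability Omega R) (PS : probability OmegaS R).

Definition boot_tuple (Sn : {RV P >-> R}) (Sbn : nat -> {RV P >-> R})
    (M : nat) (w : Omega) : M.+1.-tuple R :=
  [the M.+1.-tuple R of Sn w :: [tuple Sbn i w | i < M]].

Lemma measurable_boot_tuple Sn Sbn M :
  measurable_fun setT (boot_tuple Sn Sbn M).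
Proof.
apply: measurable_cons; first exact: measurable_funPT.
apply/measurable_fun_tnthP => i.
apply: (eq_measurable_fun (Sbn i)); last exact: measurable_funPT.
by move=> w _ /=; rewrite tnth_mktuple.
Qed.

HB.instance Definition _ Sn Sbn M :=
  isMeasurableFun.Build _ _ _ _ (boot_tuple Sn Sbn M)
    (@measurable_boot_tuple Sn Sbn M).

Variables (S_ : nat -> {RV P >-> R}) (Sb : nat -> nat -> {RV P >-> R})
  (S : {RV PS >-> R}).

Definition joint_weak_cvg (M : nat) : Prop :=
  weak_cvg_tuple (fun n => distribution P (boot_tuple (S_ n) (Sb n) M))
    (tensor_power (distribution PS S) M.+1).

Definition consistency_a : Prop := joint_weak_cvg 2.

Definition consistency_b : Prop := forall M : nat, (2 <= M)%N -> joint_weak_cvg M.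

Definition consistency_d : Prop :=
  cvg_in_prob0 P (filter_prod \oo \oo) (fun (p : nat * nat) w =>
    dBL (empirical (fun i => Sb p.1 i w) p.2) (distribution P (S_ p.1))).

Definition consistency_f : Prop :=
  cvg_in_prob0 P (filter_prod \oo \oo) (fun (p : nat * nat) w =>
    dK (empirical (fun i => Sb p.1 i w) p.2) (distribution P (S_ p.1))).

Context {dX : nat -> measure_display} {XX : forall n, measurableType (dX n)}.
Variables (X : forall n, {RV P >-> XX n}) (K : forall n, R.-pker (XX n) ~> R).

Definition consistency_c : Prop :=
  cvg_in_prob0 P \oo (fun n w => dBL (K n (X n w)) (distribution P (S_ n))).

Definition consistency_e : Prop :=
  cvg_in_prob0 P \oo (fun n w => dK (K n (X n w)) (distribution P (S_ n))).

End consistency.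

(* Main.v *)
Require Import Defs.
From HB Require Import structures.
From mathcomp Require Import all_boot all_order all_algebra finmap.
From mathcomp Require Import all_classical all_reals all_analysis.
From mathcomp Require Import measurable_realfun ring lra.

Set Implicit Arguments.
Unset Strict Implicit.
Unset Printing Implicit Defensive.

Import Order.TTheory GRing.Theory Num.Theory.
Import numFieldNormedType.Exports.

Local Open Scope classical_set_scope.
Local Open Scope ring_scope.

(* Fix x and write c = F(x), p_n = P(S_n^(1) <= x) and
   q_n = P(S_n^(1) <= x, S_n^(2) <= x). Conditional independence gives
     E (F_n(x) - c)^2 = v_n   and   E (F_n^M(x) - c)^2 = v_n + (p_n - q_n) / M,
   where v_n = q_n - 2 c p_n + c^2. Hence F_n(x) -> F(x) in probability for all x
   iff F_n^M(x) -> F(x) in probability for all x, iff v_n -> 0 for all x. Each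
   consistency assertion yields one of these: (a) and (b) give v_n -> 0 by testing
   against products of ramp functions, while (c)-(f) give pointwise convergence,
   since both distances control distribution functions up to a small shift.

   If F(a) = 1 - alpha - e and F(b) = 1 - alpha + e, then with high probability
   the random distribution function is below 1 - alpha at a and above it at b, so
   its quantile lies in [a, b]; comparing S_n with a and b and letting e -> 0
   gives the limit, even where F is flat at level 1 - alpha. *)

(** * Integral probability metrics and their measurability *)

Section integral_probability_metric.
Context {R : realType}.
Local Open Scope ereal_scope.

(** Common form of the two distances: [dBL] is the case [A = BL1] by conversion, and [dK] is the
    case of half-line indicators. *)
Definition ipm (A : set (R -> R)) (p q : set R -> \bar R) : \bar R :=
  ereal_sup [set `| \int[p]_x (f x)%:E - \int[q]_x (f x)%:E | | f in A].

Lemma integrable_le1 (p : {measure set R -> \bar R}) (f : R -> R) :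
  p setT <= 1 -> measurable_fun setT f -> (forall x, `|f x| <= 1)%R ->
  p.-integrable setT (EFin \o f).
Proof.
move=> p1 mf f1; apply: measurable_bounded_integrable => //.
  by rewrite (le_lt_trans p1)// ltry.
exists 1%R; split; rewrite ?num_real // => M M1 x _ /=.
by rewrite (le_trans (f1 x) (ltW M1)).
Qed.

Lemma cvg_integral_le1 (p : {measure set R -> \bar R}) (g : nat -> R -> R)
    (f : R -> R) :
  p setT <= 1 -> (forall n, measurable_fun setT (g n)) ->
  measurable_fun setT f -> (forall n x, `|g n x| <= 1)%R ->
  (forall x, g n x @[n --> \oo] --> f x) ->
  \int[p]_x (g n x)%:E @[n --> \oo] --> \int[p]_x (f x)%:E.
Proof.
move=> p1 mg mf g1 gf.
have [] := @dominated_convergence _ _ _ p setT measurableT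
  (fun n x => (g n x)%:E) (fun x => (f x)%:E) (cst 1).
- by move=> n; exact/measurable_EFinP.
- exact/measurable_EFinP.
- by apply: aeW => x _; apply/cvg_EFin; [exact: nearW|exact: gf].
- by apply: (@integrable_le1 p (cst 1%R)) => // x; rewrite /= normr1.
- by apply: aeW => x n _; rewrite /= lee_fin.
by move=> _ _.
Qed.

Lemma ipm_le (A : set (R -> R)) (p q : {measure set R -> \bar R}) f eps :
  A f -> ipm A p q <= eps ->
  `| \int[p]_x (f x)%:E - \int[q]_x (f x)%:E | <= eps.
Proof. by move=> Af; apply: le_trans; apply: ereal_sup_ubound; exists f. Qed.

(** Every member of [A] is a pointwise limit of a sequence drawn from [g]. Dominated convergence
    passes this to both integrals, so no member of [A] can exceed the supremum along [g]. *)
Lemma ipm_countable (A : set (R -> R)) (g : nat -> R -> R)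
    (p q : {measure set R -> \bar R}) :
  p setT <= 1 -> q setT <= 1 ->
  (forall f, A f -> measurable_fun setT f) ->
  (forall f, A f -> forall x, `|f x| <= 1)%R ->
  (forall n, A (g n)) ->
  (forall f, A f -> exists k : nat -> nat,
    forall x, g (k n) x @[n --> \oo] --> f x) ->
  ipm A p q = ereal_sup
    (range (fun n => `| \int[p]_x (g n x)%:E - \int[q]_x (g n x)%:E |)).
Proof.
move=> p1 q1 mA A1 Ag dense; apply/eqP; rewrite eq_le; apply/andP; split.
  apply: ge_ereal_sup => _ [f Af <-]; have [k kf] := dense _ Af.
  have gp := cvg_integral_le1 p1 (fun n => mA _ (Ag (k n))) (mA _ Af)
    (fun n => A1 _ (Ag (k n))) kf.
  have gq := cvg_integral_le1 q1 (fun n => mA _ (Ag (k n))) (mA _ Af)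
    (fun n => A1 _ (Ag (k n))) kf.
  (* Finiteness of one of the two limits excludes oo - oo in the limit of differences. *)
  have qfin : \int[q]_x (f x)%:E \is a fin_num.
    by apply: integrable_fin_num => //; apply: integrable_le1 => //; auto.
  have : `| \int[p]_x (g (k n) x)%:E - \int[q]_x (g (k n) x)%:E |
      @[n --> \oo] --> `| \int[p]_x (f x)%:E - \int[q]_x (f x)%:E |.
    apply: cvg_abse; apply: cvgeB => //.
    by rewrite fin_num_adde_defl // fin_numN.
  move=> /cvg_lim => <- //.
  apply: lime_le; first by apply/cvg_ex; eexists; apply: cvg_abse; apply: cvgeB gp gq;
    rewrite fin_num_adde_defl // fin_numN.
  by apply: nearW => n; apply: ereal_sup_ubound; exists (k n).
by apply: ge_ereal_sup => _ [n _ <-]; apply: ereal_sup_ubound; exists (g n).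
Qed.

(* The measure of a non-measurable set is unspecified in MathComp-Analysis, so
   convergence in probability of a distance is usable only once the distance is
   known to be measurable; hence the reduction to a countable family. *)
Lemma measurable_ipm d (Omega : measurableType d)
    (mu : Omega -> {measure set R -> \bar R}) (q : {measure set R -> \bar R})
    (A : set (R -> R)) (g : nat -> R -> R) :
  (forall B, measurable B -> measurable_fun setT (mu ^~ B)) ->
  (forall w, mu w setT <= 1) -> q setT <= 1 ->
  (forall f, A f -> measurable_fun setT f) ->
  (forall f, A f -> forall x, `|f x| <= 1)%R ->
  (forall n, A (g n)) ->
  (forall f, A f -> exists k : nat -> nat,
    forall x, g (k n) x @[n --> \oo] --> f x) ->
  measurable_fun setT (fun w => ipm A (mu w) q).
Proof.
move=> mmu mu1 q1 mA A1 Ag dense.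
under [X in measurable_fun _ X]eq_fun do
  rewrite (ipm_countable (mu1 _) q1 mA A1 Ag dense).
have -> : (fun w => ereal_sup (range (fun n =>
    `| \int[mu w]_x (g n x)%:E - \int[q]_x (g n x)%:E |))) =
  (fun w => esups (fun n =>
    `| \int[mu w]_x (g n x)%:E - \int[q]_x (g n x)%:E |) 0%N).
  apply/funext => w; rewrite /esups /sdrop /=; congr ereal_sup.
  by apply/seteqP; split=> [_ [n _ <-]|_ [n _ <-]] /=; exists n.
apply: (measurable_fun_esups (f := fun n w =>
  `| \int[mu w]_x (g n x)%:E - \int[q]_x (g n x)%:E |)) => n.
apply: measurableT_comp => //; apply: emeasurable_funB => //.
have mgn : measurable_fun setT (EFin \o g n) by apply/measurable_EFinP; exact: mA.
(* Splitting into positive and negative parts reduces to kernel integrals of nonnegative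
   functions. *)
under [X in measurable_fun _ X]eq_fun do rewrite integralE.
by apply: emeasurable_funB; apply: measurable_fun_integral_kernel => //;
  [exact: measurable_funepos|exact: measurable_funeneg].
Qed.

Definition step (x : R) : R -> R := (\1_`]-oo, x])%R.

Lemma step_ge0 x y : (0 <= step x y)%R.
Proof. by rewrite /step indicE. Qed.

Lemma stepE x y : step x y = ((y <= x)%R%:R)%R.
Proof. by rewrite /step indicE mem_setE ?in_itv. Qed.

Lemma measurable_step x : measurable_fun setT (step x).
Proof. exact: measurable_indic. Qed.

Lemma norm_step_le1 x y : (`|step x y| <= 1)%R.
Proof. by rewrite stepE; case: (y <= x)%R; rewrite ?normr1 ?normr0. Qed.

Lemma dK_ipm (p q : {measure set R -> \bar R}) : dK p q = ipm (range step) p q.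
Proof.
rewrite /dK /ipm; congr ereal_sup; apply/seteqP; split=> [_ [x _ <-]|_ [_ [x _ <-] <-]].
  by exists (step x); [exists x|rewrite !integral_indic// !setIT].
by exists x => //; rewrite !integral_indic// !setIT.
Qed.

(** Enumeration of the half-line indicators with rational endpoint; a code that decodes to no
    rational is sent to the endpoint 0. *)
Definition rat_step (n : nat) : R -> R :=
  step (ratr (odflt 0%R (choice.unpickle n))).

(** Rational endpoints approach [a] from strictly above: points [x <= a] then always stay inside the
    half-line, and each [x > a] eventually falls outside. *)
Lemma rat_step_dense f : range step f -> exists k : nat -> nat,
  forall x, rat_step (k n) x @[n --> \oo] --> f x.
Proof.
move=> [a _ <-].
have /choice[r rP] n : exists r : rat, (a < ratr r < a + n.+1%:R^-1)%R.
  have : (a < a + n.+1%:R^-1)%R by rewrite ltrDl.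
  by move=> /rat_in_itvoo [r]; rewrite in_itv/=; exists r.
exists (fun n => choice.pickle (r n)) => x; rewrite /rat_step.
apply/cvgrPdist_lt => e e0.
have [xa|ax] := leP x a.
  near=> n; rewrite choice.pickleK /= !stepE xa.
  by rewrite (le_trans xa) ?subrr ?normr0//; case/andP: (rP n) => /ltW.
have xa0 : (0 < x - a)%R by rewrite subr_gt0.
near=> n; rewrite choice.pickleK /= !stepE !leNgt ax /=.
suff -> : (ratr (r n) < x)%R by rewrite subrr normr0.
case/andP: (rP n) => _ /lt_trans; apply.
rewrite -ltrBrDl; near: n.
exact: near_infty_natSinv_lt (PosNum xa0).
Unshelve. all: by end_near. Qed.

End integral_probability_metric.

(** * Bounded Lipschitz functions: a countable dense family, and ramps *)

Section bounded_lipschitz.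
Context {R : realType}.
Implicit Types (f : R -> R) (x y h : R).

Lemma BL1_lipschitz f : (forall x, `|f x| <= 1) ->
  (forall x y, f x <= f y + `|x - y|) -> BL1 f.
Proof.
move=> f1 fL; split=> // x y; rewrite ler_norml lerBlDl fL andbT.
by rewrite lerBrDl lerBlDr distrC fL.
Qed.

Lemma BL1_continuous f : BL1 f -> continuous f.
Proof.
move=> [_ fL] x; apply/cvgrPdist_lt => e e0; near=> y.
apply: (le_lt_trans (fL _ _)); near: y.
by apply/nbhs_ballP; exists e => //= y.
Unshelve. all: by end_near. Qed.

Lemma measurable_BL1 f : BL1 f -> measurable_fun setT f.
Proof. by move=> /BL1_continuous /continuous_measurable_fun. Qed.

(* McShane's formula f x = sup_r (f r - |x - r|) for a 1-Lipschitz f, restricted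
   to finitely many rational points r with rational values, and clipped. *)
Definition mcshane (s : seq (rat * rat)) x : R :=
  foldr (fun qa m => Num.max m (Num.min 1 (ratr qa.2 - `|x - ratr qa.1|))) (-1) s.

Lemma mcshane_le s x c : -1 <= c ->
  (forall qa, qa \in s -> ratr qa.2 - `|x - ratr qa.1| <= c) -> mcshane s x <= c.
Proof.
move=> c1; elim: s => [//|qa s IH] H /=; rewrite ge_max IH /=; last first.
  by move=> qa' qa's; apply: H; rewrite inE qa's orbT.
by rewrite ge_min H ?orbT// inE eqxx.
Qed.

Lemma mcshane_ge s x (qa : rat * rat) : qa \in s ->
  Num.min 1 (ratr qa.2 - `|x - ratr qa.1|) <= mcshane s x.
Proof.
elim: s => [//|qa' s IH]; rewrite inE => /orP[/eqP <-|/IH {}IH] /=.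
  by rewrite le_max lexx orbT.
by rewrite le_max IH.
Qed.

(** Constants and the cones [r - |x - q|] are 1-Lipschitz, and minima and maxima preserve this; the
    clipping keeps values in [-1, 1]. *)
Lemma BL1_mcshane s : BL1 (mcshane s).
Proof.
apply: BL1_lipschitz => [x|x y].
  rewrite ler_norml; elim: s => [|qa s /andP[IH1 IH2]] /=.
    by rewrite lexx; lra.
  by rewrite le_max IH1 /= ge_max IH2 /= ge_min lexx.
elim: s => [|qa s IH] /=; first by rewrite lerDl.
rewrite ge_max; apply/andP; split.
  by apply: (le_trans IH); rewrite lerD2r le_max lexx.
apply: (@le_trans _ _ (Num.min 1 (ratr qa.2 - `|y - ratr qa.1|) + `|x - y|)).
  rewrite -lerBlDr le_min; apply/andP; split.
    by rewrite lerBlDr ge_min; apply/orP; left; rewrite lerDl.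
  rewrite lerBlDr ge_min; apply/orP; right.
  have := ler_normD (y - x) (x - ratr qa.1); rewrite distrC.
  by rewrite (_ : y - x + (x - ratr qa.1) = y - ratr qa.1); [lra|ring].
by rewrite lerD2r le_max lexx orbT.
Qed.

(** The n-th approximant uses the first n codes of rationals, with values taken below [f] by less
    than 1/(n+1). The Lipschitz bound keeps every cone below [f x], while a rational near [x]
    supplies a cone almost reaching [f x]. *)
Lemma mcshane_dense f : BL1 f -> exists k : nat -> seq (rat * rat),
  forall x, mcshane (k n) x @[n --> \oo] --> f x.
Proof.
move=> [f1 fL].
pose q i : rat := odflt 0 (choice.unpickle i).
have /choice[a aP] (ni : nat * nat) : exists r : rat,
    f (ratr (q ni.2)) - ni.1.+1%:R^-1 < ratr r < f (ratr (q ni.2)).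
  have : f (ratr (q ni.2)) - ni.1.+1%:R^-1 < f (ratr (q ni.2)).
    by rewrite ltrBlDr ltrDl.
  by move=> /rat_in_itvoo [r]; rewrite in_itv/=; exists r.
exists (fun n => [seq (q i, a (n, i)) | i <- iota 0 n]) => x.
apply/cvgrPdist_le => /= e e0.
(* Three errors of size e/4 occur: the height of the cone at [r], the rational value below [f r],
   and the variation of [f] between [r] and [x]. *)
have e40 : 0 < e / 4 by lra.
have xe : x - e / 4 < x + e / 4 by lra.
have [r] := rat_in_itvoo xe.
rewrite in_itv/= => /andP[r1 r2].
have xr : `|x - ratr r| <= e / 4 by rewrite ler_norml; apply/andP; split; lra.
near=> n.
have up : mcshane [seq (q i, a (n, i)) | i <- iota 0 n] x <= f x.
  apply: mcshane_le; first by have := f1 x; rewrite ler_norml => /andP[].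
  move=> _ /mapP[i _ ->] /=; have /= /andP[_ ai] := aP (n, i).
  have := fL (ratr (q i)) x; rewrite ler_norml distrC => /andP[_].
  by lra.
have rin : (r, a (n, choice.pickle r)) \in [seq (q i, a (n, i)) | i <- iota 0 n].
  apply/mapP; exists (choice.pickle r); last by rewrite /q choice.pickleK.
  by rewrite mem_iota /= add0n; near: n; exact: nbhs_infty_gt.
have := mcshane_ge x rin => /=.
have /= := aP (n, choice.pickle r); rewrite /q choice.pickleK /= => /andP[a1 a2].
have n1 : (n.+1%:R^-1 : R) < e / 4.
  by near: n; exact: near_infty_natSinv_lt (PosNum e40).
have a3 : f (ratr r) - e / 4 < ratr (a (n, choice.pickle r)).
  by apply: lt_trans a1; rewrite ltrD2l ltrN2.
have := f1 (ratr r); rewrite ler_norml => /andP[_ fr1].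
have xr0 := normr_ge0 (x - ratr r).
(* Clipping at 1 has no effect here, since the value lies below [f r <= 1]. *)
have /min_idPr -> : ratr (a (n, choice.pickle r)) - `|x - ratr r| <= 1 by lra.
have := fL x (ratr r); rewrite ler_norml => /andP[_ fxr] H.
by rewrite /q /= in up; rewrite ler_norml; apply/andP; split; lra.
Unshelve. all: by end_near. Qed.

(** A code that decodes to no list is sent to the empty list, that is to the constant -1, which is
    still in [BL1]. *)
Definition BL1_seq (n : nat) : R -> R :=
  mcshane (odflt [::] (choice.unpickle n)).

Lemma BL1_seq_dense f : BL1 f -> exists k : nat -> nat,
  forall x, BL1_seq (k n) x @[n --> \oo] --> f x.
Proof.
move=> /mcshane_dense[k kf]; exists (fun n => choice.pickle (k n)) => x.
rewrite /BL1_seq; under eq_fun do rewrite choice.pickleK /=.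
exact: kf.
Qed.

(** Equal to [h] up to [x], to 0 from [x + h] on, with slope -1 between. The height [h] rather than
    1 makes it 1-Lipschitz, at the price of a factor [h] in every comparison with [step]. *)
Definition ramp x h y : R := Num.min h (Num.max 0 (x + h - y)).

Lemma BL1_ramp x h : 0 < h <= 1 -> BL1 (ramp x h).
Proof.
move=> /andP[h0 h1]; apply: BL1_lipschitz => [y|y z]; rewrite /ramp.
  rewrite ger0_norm; first by rewrite ge_min h1.
  by rewrite le_min (ltW h0) le_max lexx.
have := ler_norm (z - y); rewrite (distrC z y) => yz.
have := normr_ge0 (y - z) => yz0.
set u := Num.max 0 (x + h - y); set v := Num.max 0 (x + h - z).
have v0 : 0 <= v by rewrite le_max lexx.
have vz : x + h - z <= v by rewrite le_max lexx orbT.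
have uv : u <= v + `|y - z| by rewrite ge_max; apply/andP; split; lra.
have mh : Num.min h u <= h by rewrite ge_min lexx.
have mu : Num.min h u <= u by rewrite ge_min lexx orbT.
by rewrite -lerBlDr le_min; apply/andP; split; lra.
Qed.

Lemma ramp_ge0 x h y : 0 < h -> 0 <= ramp x h y.
Proof. by move=> h0; rewrite le_min (ltW h0) le_max lexx. Qed.

Lemma ramp_ge_step x h y : 0 < h -> h * step x y <= ramp x h y.
Proof.
move=> h0; rewrite stepE; have [yx|xy] := leP y x; last first.
  by rewrite mulr0 ramp_ge0.
by rewrite mulr1 le_min lexx /= le_max; apply/orP; right; lra.
Qed.

Lemma ramp_le_step x h y : 0 < h -> ramp x h y <= h * step (x + h) y.
Proof.
move=> h0; rewrite stepE; have [yx|xy] := leP y (x + h).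
  by rewrite mulr1 ge_min lexx.
by rewrite mulr0 ge_min; apply/orP; right; rewrite ge_max lexx /=; lra.
Qed.

End bounded_lipschitz.

(** * Control of distribution functions by the two distances *)

Section brackets.
Context {R : realType}.
Implicit Types (p q : {measure set R -> \bar R}) (x h : R).
Local Open Scope ereal_scope.

Lemma integral_cstM_step p x h : (0 < h)%R ->
  \int[p]_y (h * step x y)%:E = h%:E * p `]-oo, x]%classic.
Proof.
move=> h0; under eq_integral do rewrite EFinM.
rewrite ge0_integralZl_EFin//; last 3 first.
- by move=> y _; rewrite lee_fin step_ge0.
- by apply/measurable_EFinP; exact: measurable_step.
- exact: ltW.
by rewrite integral_indic// setIT.
Qed.

Lemma measurable_ramp x h : (0 < h <= 1)%R ->
  measurable_fun setT (EFin \o ramp x h).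
Proof. by move=> h01; apply/measurable_EFinP; apply: measurable_BL1; exact: BL1_ramp. Qed.

Lemma integral_ramp_ge p x h : (0 < h <= 1)%R ->
  h%:E * p `]-oo, x]%classic <= \int[p]_y (ramp x h y)%:E.
Proof.
move=> h01; have /andP[h0 _] := h01; rewrite -integral_cstM_step//.
apply: ge0_le_integral => //.
- by move=> y _; rewrite lee_fin mulr_ge0 ?step_ge0// ltW.
- by apply/measurable_EFinP; apply: measurable_funM => //; exact: measurable_step.
- exact: measurable_ramp.
- by move=> y _; rewrite lee_fin ramp_ge_step.
Qed.

Lemma integral_ramp_le p x h : (0 < h <= 1)%R ->
  \int[p]_y (ramp x h y)%:E <= h%:E * p `]-oo, (x + h)%R]%classic.
Proof.
move=> h01; have /andP[h0 _] := h01; rewrite -integral_cstM_step//.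
apply: ge0_le_integral => //.
- by move=> y _; rewrite lee_fin ramp_ge0.
- exact: measurable_ramp.
- by apply/measurable_EFinP; apply: measurable_funM => //; exact: measurable_step.
- by move=> y _; rewrite lee_fin ramp_le_step.
Qed.

Lemma fin_num_le1 p (B : set R) : p setT <= 1 -> measurable B ->
  p B \is a fin_num.
Proof.
move=> p1 mB; rewrite ge0_fin_numE//; apply: (@le_lt_trans _ _ 1); last exact: ltry.
by apply: le_trans p1; apply: le_measure; rewrite ?inE.
Qed.

(* As in the Levy metric: the distribution functions agree up to an error h in
   both abscissa and ordinate. *)
Definition levy_control (D : (set R -> \bar R) -> (set R -> \bar R) -> \bar R) :=
  forall h, (0 < h <= 1)%R -> exists2 eps, (0 < eps)%R &
    forall p q, p setT <= 1 -> q setT <= 1 -> D p q <= eps%:E -> forall x,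
      (fine (p `]-oo, x]%classic) <= fine (q `]-oo, (x + h)%R]%classic) + h /\
       fine (q `]-oo, (x - h)%R]%classic) - h <= fine (p `]-oo, x]%classic))%R.

(** [eps = h] works: the Kolmogorov distance compares both functions at [x] itself, and monotonicity
    of [q] accounts for the shifts. *)
Lemma levy_control_dK : levy_control dK.
Proof.
move=> h /andP[h0 h1]; exists h => // p q p1 q1; rewrite dK_ipm => D x.
have : `| \int[p]_y (step x y)%:E - \int[q]_y (step x y)%:E | <= h%:E.
  by apply: ipm_le D; exists x.
rewrite !integral_indic// !setIT.
have pf y : p `]-oo, y]%classic \is a fin_num by exact: fin_num_le1.
have qf y : q `]-oo, y]%classic \is a fin_num by exact: fin_num_le1.
rewrite -(fineK (pf x)) -(fineK (qf x)) -EFinB /= lee_fin ler_norml => /andP[].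
have mono y z : (y <= z)%R ->
    (fine (q `]-oo, y]%classic) <= fine (q `]-oo, z]%classic))%R.
  by move=> yz; rewrite fine_le// le_measure ?inE//; exact: subitvPr.
have : (x <= x + h)%R by lra.
have : (x - h <= x)%R by lra.
move=> /mono ? /mono ?.
by move=> *; split; lra.
Qed.

Lemma fin_num_integral_ramp p x h : p setT <= 1 -> (0 < h <= 1)%R ->
  \int[p]_y (ramp x h y)%:E \is a fin_num.
Proof.
move=> p1 h01; apply: integrable_fin_num => //; apply: integrable_le1 => //.
  by apply: measurable_BL1; exact: BL1_ramp.
by have [] := BL1_ramp x h01.
Qed.

Lemma fine_integral_ramp_ge p x h : p setT <= 1 -> (0 < h <= 1)%R ->
  (h * fine (p `]-oo, x]%classic) <= fine (\int[p]_y (ramp x h y)%:E))%R.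
Proof.
move=> p1 h01; rewrite -lee_fin EFinM !fineK.
- exact: integral_ramp_ge.
- exact: fin_num_integral_ramp.
- exact: fin_num_le1.
Qed.

Lemma fine_integral_ramp_le p x h : p setT <= 1 -> (0 < h <= 1)%R ->
  (fine (\int[p]_y (ramp x h y)%:E) <= h * fine (p `]-oo, (x + h)%R]%classic))%R.
Proof.
move=> p1 h01; rewrite -lee_fin EFinM !fineK.
- exact: integral_ramp_le.
- exact: fin_num_le1.
- exact: fin_num_integral_ramp.
Qed.

(** [eps = h * h] works: ramp integrals under [p] and [q] then differ by at most [h * h], and
    dividing by the ramp height leaves an error [h]. The ramp starting at [x] gives the upper bound,
    the one ending at [x] the lower bound. *)
Lemma levy_control_dBL : levy_control dBL.
Proof.
move=> h h01; have /andP[h0 h1] := h01.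
exists (h * h)%R => [|p q p1 q1 D x]; first exact: mulr_gt0.
have dist y : (`|fine (\int[p]_z (ramp y h z)%:E) -
                 fine (\int[q]_z (ramp y h z)%:E)| <= h * h)%R.
  have : `| \int[p]_z (ramp y h z)%:E - \int[q]_z (ramp y h z)%:E | <= (h * h)%:E.
    by apply: ipm_le D; exact: BL1_ramp.
  rewrite -(fineK (fin_num_integral_ramp y p1 h01)).
  by rewrite -(fineK (fin_num_integral_ramp y q1 h01)) -EFinB /= lee_fin.
split; rewrite -(ler_pM2l h0).
  have := dist x; rewrite ler_norml => /andP[_].
  have := fine_integral_ramp_ge x p1 h01.
  by have := fine_integral_ramp_le x q1 h01; lra.
have := dist (x - h)%R; rewrite ler_norml => /andP[+ _].
have := fine_integral_ramp_ge (x - h)%R q1 h01.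
by have := fine_integral_ramp_le (x - h)%R p1 h01; rewrite subrK; lra.
Qed.

End brackets.

(** * Weak convergence and pointwise convergence of distribution functions *)

Section weak_limits.
Context {R : realType}.

(** One [h] serves three purposes: a ramp width ([h <= 1]), an admissible Levy error ([h <= e]), and
    a step over which [F] moves by at most [e]. *)
Lemma continuous_bracket (F : R -> R) x e : continuous F -> 0 < e ->
  exists2 h, 0 < h <= 1 & [/\ h <= e, F (x + h) <= F x + e & F x - e <= F (x - h)].
Proof.
move=> /(_ x) /cvgrPdist_le /(_ e) cF e0.
have /nbhs_ballP[r /= r0 rF] := cF e0.
have [m [m0 mr m1 me]] : exists m : R, [/\ 0 < m, m < r, m <= 1 & m <= e].
  exists (Num.min (r / 2) (Num.min 1 e)); split.
  - by rewrite !lt_min ltr01 e0 divr_gt0.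
  - by rewrite gt_min; apply/orP; left; rewrite ltr_pdivrMr// ltr_pMr//; lra.
  - by rewrite !ge_min lexx orbT.
  - by rewrite !ge_min lexx !orbT.
exists m; first by rewrite m0 m1.
have ball z : `|x - z| = m -> `|F x - F z| <= e.
  by move=> xz; apply: rF; rewrite /ball /= xz.
have := ball (x + m); have := ball (x - m).
rewrite opprB addrC subrK opprD addNKr normrN gtr0_norm// => /(_ erefl) + /(_ erefl).
by rewrite !ler_norml => /andP[? ?] /andP[? ?]; split => //; lra.
Qed.

(** The ramps starting and ending at [x] enclose the indicator of the half-line; their limiting
    integrals lie between [h] times the limit distribution function at [x - h] and at [x + h]. *)
Lemma weak_cvg_cdf (mu : nat -> {measure set R -> \bar R})
    (nu : {measure set R -> \bar R}) :
  (forall n, mu n setT <= 1)%E -> (nu setT <= 1)%E -> weak_cvg mu nu ->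
  continuous (fun x => fine (nu `]-oo, x]%classic)) ->
  forall x, fine (mu n `]-oo, x]%classic) @[n --> \oo]
    --> fine (nu `]-oo, x]%classic).
Proof.
move=> mu1 nu1 munu cF x; apply/cvgrPdist_le => /= e e0.
have e20 : 0 < e / 2 by rewrite divr_gt0.
have [h h01 [_ Fh hF]] := continuous_bracket x cF e20.
have /andP[h0 h1] := h01.
have he : 0 < h * (e / 2) by exact: mulr_gt0.
have ramp_near y : \forall n \near \oo,
    `|fine (\int[nu]_z (ramp y h z)%:E)%E - fine (\int[mu n]_z (ramp y h z)%:E)%E|
      <= h * (e / 2).
  have [r1 rL] := BL1_ramp y h01.
  have : (\int[mu n]_z (ramp y h z)%:E)%E @[n --> \oo] -->
      (\int[nu]_z (ramp y h z)%:E)%E.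
    apply: munu; first by apply: BL1_continuous; exact: BL1_ramp.
    exists 1; split; rewrite ?num_real // => M M1 z _ /=.
    by rewrite (le_trans (r1 z) (ltW M1)).
  rewrite -(fineK (fin_num_integral_ramp y nu1 h01)) => /fine_cvg.
  by move=> /cvgrPdist_le; exact.
near=> n.
have : `|fine (\int[nu]_z (ramp x h z)%:E)%E - fine (\int[mu n]_z (ramp x h z)%:E)%E|
    <= h * (e / 2) by near: n; exact: ramp_near.
have : `|fine (\int[nu]_z (ramp (x - h) h z)%:E)%E
    - fine (\int[mu n]_z (ramp (x - h) h z)%:E)%E| <= h * (e / 2).
  by near: n; exact: ramp_near.
rewrite !ler_norml => /andP[_ A] /andP[B _].
have C := fine_integral_ramp_le (x - h) (mu1 n) h01; rewrite subrK in C.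
have D := fine_integral_ramp_ge (x - h) nu1 h01.
have E := fine_integral_ramp_ge x (mu1 n) h01.
have G := fine_integral_ramp_le x nu1 h01.
apply/andP; split; rewrite -(ler_pM2l h0).
  have := ler_wpM2l (ltW h0) Fh; lra.
have := ler_wpM2l (ltW h0) hF; lra.
Unshelve. all: by end_near. Qed.

End weak_limits.

(** * Convergence in probability and in mean square *)

Section convergence_in_probability.
Context {R : realType} d (Omega : measurableType d) (P : probability Omega R).
Local Open Scope ereal_scope.

Lemma measurable_norm_gt (Z : Omega -> R) (e : R) : measurable_fun setT Z ->
  measurable [set w | e < `|Z w|]%R.
Proof.
move=> mZ; have mN : measurable_fun setT (fun w => `|Z w|)%R.
  by apply: measurableT_comp.
by have := measurable_fun_ltr (measurable_cst e) mN measurableT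
  (Logic.I : measurable [set true]); rewrite setTI.
Qed.

Definition cvg_prob0 {I : Type} (FF : set_system I) (Z : I -> Omega -> R) :=
  forall e : R, (0 < e)%R -> P [set w | e < `|Z i w|]%R @[i --> FF] --> 0.

Lemma cvg_probability0 {I : Type} (FF : set_system I) (A : I -> set Omega) :
  Filter FF -> (forall i, measurable (A i)) ->
  (forall e : R, (0 < e)%R -> \forall i \near FF, P (A i) <= e%:E) ->
  P (A i) @[i --> FF] --> 0.
Proof.
move=> FFF mA H; apply/fine_cvgP; split.
  by apply: nearW => i; rewrite fin_num_measure.
apply/cvgrPdist_le => /= e e0; apply: filterS (H e e0) => i.
rewrite sub0r normrN ger0_norm ?fine_ge0//.
by rewrite -lee_fin fineK// fin_num_measure.
Qed.

Lemma near_cvg_probability0 {I : Type} (FF : set_system I) (A : I -> \bar R) :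
  Filter FF -> A i @[i --> FF] --> 0 ->
  forall e : R, (0 < e)%R -> \forall i \near FF, A i <= e%:E.
Proof.
move=> FFF /fine_cvgP[fA /cvgrPdist_le cA] e e0.
apply: filterS2 fA (cA e e0) => i fi /=.
rewrite sub0r normrN -[in X in _ -> X](fineK fi) lee_fin.
by apply: le_trans; exact: ler_norm.
Qed.

(** Chebyshev's inequality. *)
Lemma markov_sqr (Z : Omega -> R) (e : R) : (0 < e)%R -> measurable_fun setT Z ->
  (e ^+ 2)%:E * P [set w | e < `|Z w|]%R <= \int[P]_w ((Z w) ^+ 2)%:E.
Proof.
move=> e0 mZ; have mA := measurable_norm_gt e mZ.
rewrite -[X in P X]setIT -integral_indic// -ge0_integralZl_EFin ?sqr_ge0//; last first.
  by apply/measurable_EFinP; exact: measurable_indic.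
apply: ge0_le_integral => //.
- by move=> w _; rewrite -EFinM lee_fin mulr_ge0 ?sqr_ge0.
- by apply/measurable_EFinP; apply: measurable_funM => //; exact: measurable_indic.
- by apply/measurable_EFinP; exact: measurable_funX.
- move=> w _; rewrite -EFinM lee_fin indicE; have [eZ|Ze] := ltP e `|Z w|%R.
    rewrite mem_set// mulr1.
    by rewrite -(real_normK (num_real (Z w))) lerXn2r ?nnegrE// ltW.
  by rewrite memNset ?mulr0 ?sqr_ge0//=; apply/negP; rewrite -leNgt.
Qed.

(** A reverse Chebyshev inequality for bounded variables: [Z ^+ 2] is at most 1 where [e < |Z|] and
    at most [e ^+ 2] elsewhere. *)
Lemma integral_sqr_le (Z : Omega -> R) (e : R) : (0 <= e)%R ->
  measurable_fun setT Z -> (forall w, `|Z w| <= 1)%R ->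
  \int[P]_w ((Z w) ^+ 2)%:E <= (e ^+ 2)%:E + P [set w | e < `|Z w|]%R.
Proof.
move=> e0 mZ Z1; have mA := measurable_norm_gt e mZ.
rewrite -[X in _ + P X]setIT -integral_indic//.
have -> : (e ^+ 2)%:E = \int[P]_w (cst (e ^+ 2)%:E w).
  by rewrite integral_cst//= (@probability_setT _ _ _ P) mule1.
rewrite -ge0_integralD//; last 2 first.
- by move=> w _; rewrite lee_fin sqr_ge0.
- by apply/measurable_EFinP; exact: measurable_indic.
apply: ge0_le_integral => //.
- by move=> w _; rewrite lee_fin sqr_ge0.
- by apply/measurable_EFinP; exact: measurable_funX.
- by apply: emeasurable_funD => //; apply/measurable_EFinP; exact: measurable_indic.
- move=> w _; rewrite -EFinD lee_fin indicE; have [eZ|Ze] := ltP e `|Z w|%R.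
    rewrite mem_set//; rewrite -(real_normK (num_real (Z w))).
    by rewrite (@le_trans _ _ 1%R)// ?exprn_ile1// lerDr sqr_ge0.
  rewrite memNset /=; last by apply/negP; rewrite -leNgt.
  by rewrite addr0 -(real_normK (num_real (Z w))) lerXn2r ?nnegrE.
Qed.

Lemma cvg_prob0_sqr {I : Type} (FF : set_system I) (Z : I -> Omega -> R) :
  Filter FF -> (forall i, measurable_fun setT (Z i)) ->
  (forall i w, `|Z i w| <= 1)%R ->
  cvg_prob0 FF Z ->
  forall e : R, (0 < e)%R ->
    \forall i \near FF, \int[P]_w ((Z i w) ^+ 2)%:E <= e%:E.
Proof.
move=> FFF mZ Z1 cZ e e0.
have e20 : (0 < e / 2)%R by rewrite divr_gt0.
(* With the threshold sqrt(e/2), both terms of [integral_sqr_le] are at most e/2. *)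
have s0 : (0 < Num.sqrt (e / 2))%R by rewrite sqrtr_gt0.
apply: filterS (near_cvg_probability0 FFF (cZ _ s0) e20) => i Hi.
apply: (le_trans (integral_sqr_le (ltW s0) (mZ i) (Z1 i))).
rewrite sqr_sqrtr ?(ltW e20)//.
by rewrite [leRHS](_ : _ = (e / 2)%:E + (e / 2)%:E) ?leeD2l// -EFinD -splitr.
Qed.

Lemma sqr_cvg_prob0 {I : Type} (FF : set_system I) (Z : I -> Omega -> R) :
  Filter FF -> (forall i, measurable_fun setT (Z i)) ->
  (forall e : R, (0 < e)%R ->
    \forall i \near FF, \int[P]_w ((Z i w) ^+ 2)%:E <= e%:E) ->
  cvg_prob0 FF Z.
Proof.
move=> FFF mZ cZ e e0; apply: cvg_probability0 => [i|r r0].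
  exact: measurable_norm_gt.
have er : (0 < e ^+ 2 * r)%R by rewrite mulr_gt0// exprn_gt0.
apply: filterS (cZ _ er) => i Hi.
have := le_trans (markov_sqr e0 (mZ i)) Hi.
by rewrite (EFinM (e ^+ 2)) lee_pmul2l// lte_fin exprn_gt0.
Qed.

(** Where [D <= eps], the random distribution function at [x] is trapped between those of [q] at
    [x - h] and [x + h], which are close to [F x]. The map [nu] extracts [n] from the index, so that
    both [n] and pairs [(n, M)] are covered. *)
Lemma levy_cvg_prob {I : Type} (FF : set_system I) (nu : I -> nat)
    (D : (set R -> \bar R) -> (set R -> \bar R) -> \bar R)
    (mu : I -> Omega -> {measure set R -> \bar R})
    (q : nat -> {measure set R -> \bar R}) (F : R -> R) :
  Filter FF -> nu @ FF --> \oo -> levy_control D ->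
  (forall i w, mu i w setT <= 1) -> (forall n, q n setT <= 1) ->
  (forall i B, measurable B -> measurable_fun setT (mu i ^~ B)) ->
  (forall i, measurable_fun setT (fun w => D (mu i w) (q (nu i)))) ->
  continuous F -> (forall x, fine (q n `]-oo, x]%classic) @[n --> \oo] --> F x) ->
  cvg_in_prob0 P FF (fun i w => D (mu i w) (q (nu i))) ->
  forall x, cvg_prob0 FF (fun i w => fine (mu i w `]-oo, x]%classic) - F x)%R.
Proof.
move=> FFF nuoo Dlevy mu1 q1 mmu mD cF qF Dcvg x e e0.
(* Three errors of size e/4 add up: the Levy error [h], the distance from [q] to [F], and the
   variation of [F] over [h]. *)
have e40 : (0 < e / 4)%R by rewrite divr_gt0.
have [h h01 [he Fh hF]] := continuous_bracket x cF e40.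
have [eps eps0 epsP] := Dlevy h h01.
have near_q y : \forall i \near FF,
    (`|F y - fine (q (nu i) `]-oo, y]%classic)| <= e / 4)%R.
  have := qF y => /cvgrPdist_le /(_ _ e40) Fy.
  by have := nuoo _ Fy; apply.
have mmux i : measurable_fun setT (fun w => fine (mu i w `]-oo, x]%classic)).
  by apply: measurableT_comp => //; exact: mmu.
apply: cvg_probability0 => [i|r r0].
  by apply: measurable_norm_gt; exact: measurable_funB.
apply: filterS3 (near_cvg_probability0 FFF (Dcvg _ eps0) r0)
  (near_q (x + h)%R) (near_q (x - h)%R) => i Hi q1i q2i.
apply: le_trans Hi; apply: le_measure; rewrite ?inE.
- by apply: measurable_norm_gt; exact: measurable_funB.
- rewrite -[X in measurable X]setTI.
  apply: emeasurable_fun_o_infty => //.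
  by apply: measurableT_comp => //; exact: mD.
- move=> w /=; apply: contraTT; rewrite -!leNgt => Dle.
  have /(epsP _ _ (mu1 i w) (q1 (nu i))) : D (mu i w) (q (nu i)) <= eps%:E.
    by apply: le_trans Dle; exact: lee_abs.
  move=> /(_ x)[A B]; move: q1i q2i; rewrite !ler_norml => /andP[? ?] /andP[? ?].
  by apply/andP; split; lra.
Qed.

End convergence_in_probability.

(** * Measurability of random quantiles, and probabilities of exceeding them *)

Section quantile.
Context {R : realType} d (Omega : measurableType d).

Lemma measurable_set_le (f g : Omega -> R) : measurable_fun setT f ->
  measurable_fun setT g -> measurable [set w | f w <= g w].
Proof.
by move=> mf mg; rewrite -[X in measurable X]setTI; exact: measurable_fun_le.
Qed.

Lemma measurable_set_lt (f g : Omega -> R) : measurable_fun setT f ->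
  measurable_fun setT g -> measurable [set w | f w < g w].
Proof.
move=> mf mg; rewrite (_ : [set w | f w < g w] = ~` [set w | g w <= f w]).
  by apply: measurableC; exact: measurable_set_le.
by apply/seteqP; split=> w /=; rewrite ltNge => /negP.
Qed.

(* [G w] is not assumed to be a distribution function, so [inf] may take its junk
   value 0; this happens on the measurable complement of N `&` L below. *)
Lemma measurable_gen_inv (G : Omega -> R -> R) (y : R) :
  (forall w, {homo G w : a b / a <= b}) ->
  (forall x, measurable_fun setT (G ^~ x)) ->
  measurable_fun setT (fun w => gen_inv (G w) y).
Proof.
move=> ndG mG; apply: (measurability _ (RGenInftyO.measurableE R)) => //.
move=> _ [_ [t ->] <-]; rewrite setTI.
pose N := \bigcup_(r : rat) [set w | y <= G w (ratr r)].
pose L := \bigcup_(r : rat) [set w | G w (ratr r) < y].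
pose B := \bigcup_(r : rat) [set w | ratr r < t /\ y <= G w (ratr r)].
have mN : measurable N.
  by apply: bigcupT_measurable_rat => r; exact: measurable_set_le.
have mL : measurable L.
  by apply: bigcupT_measurable_rat => r; exact: measurable_set_lt.
have mB : measurable B.
  apply: bigcupT_measurable_rat => r; have [rt|tr] := ltP (ratr r) t.
    rewrite [X in measurable X](_ : _ = [set w | y <= G w (ratr r)]).
      exact: measurable_set_le.
    by apply/seteqP; split=> w /=; [case|split].
  rewrite [X in measurable X](_ : _ = set0)//.
  by apply/seteqP; split=> w //= [].
(* Monotonicity moves a point where level [y] is reached to a rational slightly to its right, so
   countable unions suffice. *)
have Nbelow w x : y <= G w x -> forall z, x < z ->
    exists2 r : rat, ratr r < z & y <= G w (ratr r).
  move=> yx z xz; have [r] := rat_in_itvoo xz; rewrite in_itv/= => /andP[xr rz].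
  by exists r => //; rewrite (le_trans yx)// ndG// ltW.
have has_infE w : has_inf [set x | y <= G w x] <-> (N `&` L) w.
  split=> [[[x yx] [b bA]]|[[r _ /= yr] [q _ /= qy]]].
    split; first by have [|r _ yr] := @Nbelow w x yx (x + 1); [rewrite ltrDl|exists r].
    have [|r] := @rat_in_itvoo R (b - 1) b; first by rewrite ltrBlDr ltrDl.
    rewrite in_itv/= => /andP[_ rb]; exists r => //=.
    by rewrite ltNge; apply/negP => /bA; rewrite leNgt rb.
  split; first by exists (ratr r).
  exists (ratr q) => x /= yx; rewrite leNgt; apply/negP => /ltW /(ndG w) xq.
  by move: qy; rewrite ltNge (le_trans yx xq).
rewrite (_ : _ @^-1` _ = (N `&` L `&` B) `|` (~` (N `&` L) `&` [set _ | 0 < t])).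
  apply: measurableU; first by apply: measurableI => //; exact: measurableI.
  by apply: measurableI; [apply: measurableC; exact: measurableI|
    exact: measurable_set_lt].
apply/seteqP; split=> w /=; rewrite in_itv/=.
  move=> inft; have [/has_infE wi|wi] := pselect ((N `&` L) w).
    left; split; first exact/has_infE.
    have [x yx xt] := inf_lt wi.1 inft.
    by have [r rt yr] := Nbelow w x yx t xt; exists r.
  right; split => //; move: inft; rewrite /gen_inv inf_out//.
  by move=> /has_infE.
move=> [[/has_infE [_ lb] [r _ [rt yr]]]|[wi t0]].
  by apply: le_lt_trans rt; exact: ge_inf.
by rewrite /gen_inv inf_out// => /has_infE.
Qed.

Variable P : probability Omega R.

(** [A i] is any event between the strict and the weak exceedance of the quantile, so one argument
    serves both inequalities. *)
Lemma quantile_events (I : Type) (FF : set_system I) (G : I -> Omega -> R -> R)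
    (S : I -> Omega -> R) (F : R -> R) (alpha : R) (A : I -> set Omega) :
  Filter FF ->
  (forall i w, {homo G i w : a b / a <= b}) ->
  (forall i x, measurable_fun setT (G i ^~ x)) ->
  (forall i, measurable_fun setT (S i)) ->
  (forall i, measurable (A i)) ->
  (forall i w, gen_inv (G i w) (1 - alpha) < S i w -> A i w) ->
  (forall i w, A i w -> gen_inv (G i w) (1 - alpha) <= S i w) ->
  {homo F : a b / a <= b} ->
  (forall u, 0 < u < 1 -> exists x, F x = u) ->
  (forall x, cvg_prob0 P FF (fun i w => G i w x - F x)) ->
  (forall x, fine (P [set w | S i w <= x]) @[i --> FF] --> F x) ->
  0 < alpha < 1 ->
  P (A i) @[i --> FF] --> alpha%:E.
Proof.
move=> FFF ndG mG mS mA subA Asub ndF F01 GF SF /andP[alpha0 alpha1].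
apply/fine_cvgP; split; first by apply: nearW => i; rewrite fin_num_measure.
apply/cvgrPdist_le => /= e0 e00.
(* The last two bounds keep the levels [1 - alpha + e] and [1 - alpha - 2 * e] inside (0, 1). The
   final error is at most [3 * e] below and [4 * e] above, whence [e0 / 4]. *)
pose e := Num.min (e0 / 4) (Num.min (alpha / 2) ((1 - alpha) / 4)).
have e_gt0 : 0 < e by rewrite !lt_min !divr_gt0 ?subr_gt0.
have e_e0 : e <= e0 / 4 by rewrite ge_min lexx.
have e_alpha : e <= alpha / 2 by rewrite !ge_min lexx !orbT.
have e_alpha1 : e <= (1 - alpha) / 4 by rewrite !ge_min lexx !orbT.
have [a' Fa'] : exists x, F x = 1 - alpha - 2 * e by apply: F01; apply/andP; split; lra.
have [a Fa] : exists x, F x = 1 - alpha - e by apply: F01; apply/andP; split; lra.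
have [b Fb] : exists x, F x = 1 - alpha + e by apply: F01; apply/andP; split; lra.
(* On the good event the quantile is only known to be >= a; passing to a' < a turns
   S >= quantile into S > a', whose probability is read off the cdf. *)
have a'a : a' < a by rewrite ltNge; apply/negP => /ndF; rewrite Fa Fa'; lra.
have e20 : 0 < e / 2 by rewrite divr_gt0.
(* The tolerance e/2 is smaller than the gap [e] between level [1 - alpha] and the values of [F] at
   [a] and [b], so off the bad events [G] is strictly below the level at [a] and above it at [b]. *)
pose bad x i := [set w | e / 2 < `|G i w x - F x|].
have mbad x i : measurable (bad x i).
  by apply: measurable_norm_gt; exact: measurable_funB.
have near_bad x : \forall i \near FF, fine (P (bad x i)) <= e / 2.
  apply: filterS (near_cvg_probability0 FFF (GF x _ e20) e20) => i.
  by rewrite -{1}[P _]fineK ?lee_fin// fin_num_measure//; exact: mbad.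
have near_S x : \forall i \near FF, `|F x - fine (P [set w | S i w <= x])| <= e.
  by have /cvgrPdist_le := SF x; exact.
have mSle x i : measurable [set w | S i w <= x] by exact: measurable_set_le.
have mSgt x i : measurable [set w | x < S i w] by exact: measurable_set_lt.
have PSgt x i : fine (P [set w | x < S i w]) = 1 - fine (P [set w | S i w <= x]).
  rewrite (_ : [set w | x < S i w] = ~` [set w | S i w <= x]).
    by rewrite probability_setC// fineB// fin_num_measure.
  by apply/seteqP; split=> w /=; rewrite ltNge => /negP.
have leP (B C : set Omega) : measurable B -> measurable C -> B `<=` C ->
    fine (P B) <= fine (P C).
  by move=> mB mC BC; rewrite fine_le ?fin_num_measure// le_measure ?inE.
have leU (B C : set Omega) : measurable B -> measurable C ->
    fine (P (B `|` C)) <= fine (P B) + fine (P C).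
  move=> mB mC; rewrite -fineD ?fin_num_measure// fine_le ?fin_num_measure//.
  - exact: measurableU.
  - by rewrite fin_numD !fin_num_measure.
  - exact: measureU2.
have A_ge i : [set w | b < S i w] `<=` A i `|` (bad a i `|` bad b i).
  move=> w /= bS; have [wb|wb] := pselect ((bad a i `|` bad b i) w); first by right.
  left; apply: subA; apply: le_lt_trans bS.
  have /negP : ~ bad a i w by apply: contra_not wb; left.
  rewrite -leNgt ler_norml => /andP[_ Ga].
  have /negP : ~ bad b i w by apply: contra_not wb; right.
  rewrite -leNgt ler_norml => /andP[Gb _].
  apply: ge_inf => /=; last by lra.
  (* The lower bound [a] of the level set ensures that [inf] does not take its default value. *)
  exists a => x /= Gx; rewrite leNgt; apply/negP => /ltW /(ndG i w) xa; lra.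
have A_le i : A i `<=` [set w | a' < S i w] `|` (bad a i `|` bad b i).
  move=> w Aw; have [wb|wb] := pselect ((bad a i `|` bad b i) w); first by right.
  left => /=; apply: lt_le_trans (Asub _ _ Aw); apply: (lt_le_trans a'a).
  have /negP : ~ bad a i w by apply: contra_not wb; left.
  rewrite -leNgt ler_norml => /andP[_ Ga].
  have /negP : ~ bad b i w by apply: contra_not wb; right.
  rewrite -leNgt ler_norml => /andP[Gb _].
  apply: lb_le_inf; first by exists b => /=; lra.
  by move=> x /= Gx; rewrite leNgt; apply/negP => /ltW /(ndG i w) xa; lra.
near=> i.
have Ba : fine (P (bad a i)) <= e / 2 by near: i; exact: near_bad.
have Bb : fine (P (bad b i)) <= e / 2 by near: i; exact: near_bad.
have Sa : `|F a' - fine (P [set w | S i w <= a'])| <= e by near: i; exact: near_S.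
have Sb : `|F b - fine (P [set w | S i w <= b])| <= e by near: i; exact: near_S.
move: Sa Sb; rewrite !ler_norml Fa' Fb => /andP[_ Sa] /andP[Sb _].
have U := leU _ _ (mbad a i) (mbad b i).
have mU : measurable (bad a i `|` bad b i) by exact: measurableU.
have Alow := le_trans (leP _ _ (mSgt b i) (measurableU _ _ (mA i) mU) (A_ge i))
  (leU _ _ (mA i) mU).
have Aup := le_trans (leP _ _ (mA i) (measurableU _ _ (mSgt a' i) mU) (A_le i))
  (leU _ _ (mSgt a' i) mU).
rewrite !PSgt in Alow Aup.
by apply/andP; split; lra.
Unshelve. all: by end_near. Qed.

End quantile.

Lemma mean_le1 {R : realType} (a : nat -> R) (M : nat) :
  (forall i, a i <= 1) -> M%:R^-1 * \sum_(i < M) a i <= 1.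
Proof.
move=> a1; case: M => [|M]; first by rewrite big_ord0 mulr0.
rewrite mulrC ler_pdivrMr// mul1r.
apply: (@le_trans _ _ (\sum_(i < M.+1) 1)); last by rewrite sumr_const card_ord.
exact: ler_sum.
Qed.

(** * Second moments of averages of indicators *)

Section second_moments.
Context {R : realType} d (Omega : measurableType d) (P : probability Omega R).
Local Open Scope ereal_scope.

Lemma integral_sqrB (g : Omega -> R) (c p q : R) :
  measurable_fun setT g -> (forall w, `|g w| <= 1)%R ->
  \int[P]_w (g w)%:E = p%:E -> \int[P]_w ((g w) ^+ 2)%:E = q%:E ->
  \int[P]_w ((g w - c) ^+ 2)%:E = (q - 2 * c * p + c ^+ 2)%:E.
Proof.
move=> mg g1 gp gq.
have intP (f : Omega -> R) (m : R) : measurable_fun setT f ->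
    (forall w, `|f w| <= m)%R -> P.-integrable setT (EFin \o f).
  move=> mf fm; apply: measurable_bounded_integrable => //.
    by rewrite -ge0_fin_numE// fin_num_measure.
  exists m; split; rewrite ?num_real // => n mn w _ /=.
  by rewrite (le_trans (fm w) (ltW mn)).
have mg2 : measurable_fun setT (fun w => g w ^+ 2)%R by exact: measurable_funX.
have intg2 : P.-integrable setT (EFin \o (fun w => g w ^+ 2)%R).
  apply: (intP _ 1%R) => // w; rewrite normrX expr2.
  by rewrite -[leRHS]mulr1 ler_pM.
have intg : P.-integrable setT (EFin \o g) by exact: (intP _ 1%R).
have intc : P.-integrable setT (EFin \o cst (c ^+ 2)%R).
  by apply: (intP _ `|c ^+ 2|%R) => // w.
have -> : \int[P]_w ((g w - c) ^+ 2)%:E =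
    \int[P]_w (((g w ^+ 2)%:E + (- 2 * c)%:E * (g w)%:E) + (cst (c ^+ 2) w)%:E).
  by apply: eq_integral => w _; rewrite -EFinM -!EFinD /=; congr EFin; ring.
rewrite integralD//=; last first.
  by apply: integrableD => //; exact: integrableZl.
rewrite integralD//=; last exact: integrableZl.
rewrite integralZl// gp gq integral_cst//= (@probability_setT _ _ _ P) mule1.
by rewrite -EFinM -!EFinD; congr EFin; ring.
Qed.

Variables (E : nat -> set Omega) (p q : R).
Hypotheses (mE : forall i, measurable (E i)) (PE : forall i, P (E i) = p%:E)
  (PEE : forall i j, i != j -> P (E i `&` E j) = q%:E).

Definition mean_indic (M : nat) (w : Omega) : R :=
  (M%:R^-1 * \sum_(i < M) \1_(E i) w)%R.

Lemma mean_indic_ge0 M w : (0 <= mean_indic M w)%R.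
Proof. by rewrite mulr_ge0 ?invr_ge0// sumr_ge0. Qed.

Lemma mean_indic_le1 M w : (mean_indic M w <= 1)%R.
Proof.
by apply: (mean_le1 (a := fun i => \1_(E i) w)) => i; rewrite indicE;
  case: (w \in E i).
Qed.

Lemma measurable_mean_indic M : measurable_fun setT (mean_indic M).
Proof.
apply: measurable_funM => //; apply: measurable_sum => i.
exact: measurable_indic.
Qed.

Lemma integral_mean_indic M : (0 < M)%N ->
  \int[P]_w (mean_indic M w)%:E = p%:E.
Proof.
move=> M0; under eq_integral do rewrite EFinM -sumEFin.
rewrite ge0_integralZl_EFin ?invr_ge0//; last 2 first.
- by move=> w _; rewrite sume_ge0// => i _; rewrite lee_fin.
- by apply: emeasurable_sum => i; apply/measurable_EFinP; exact: measurable_indic.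
rewrite ge0_integral_sum//; last first.
  by move=> i; apply/measurable_EFinP; exact: measurable_indic.
rewrite (eq_bigr (fun=> p%:E)); last first.
  by move=> i _; rewrite integral_indic// setIT; exact: PE.
rewrite sumEFin -EFinM sumr_const card_ord -[(p *+ M)%R]mulr_natl mulKf//.
by rewrite pnatr_eq0 -lt0n.
Qed.

(** Expanding the square gives M diagonal terms [p] and M(M-1) off-diagonal terms [q], all divided
    by the square of M. *)
Lemma integral_mean_indic_sqr M : (0 < M)%N ->
  \int[P]_w ((mean_indic M w) ^+ 2)%:E = (q + (p - q) / M%:R)%:E.
Proof.
move=> M0.
have sqrE w : (mean_indic M w ^+ 2)%:E =
    ((M%:R^-1) ^+ 2)%:E * \sum_(i < M) \sum_(j < M) (\1_(E i `&` E j) w)%:E.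
  rewrite /mean_indic exprMn EFinM; congr *%E.
  under [RHS]eq_bigr do rewrite sumEFin.
  rewrite sumEFin; congr EFin.
  rewrite expr2 mulr_suml; apply: eq_bigr => i _.
  by rewrite mulr_sumr; apply: eq_bigr => j _; rewrite indicI.
under eq_integral do rewrite sqrE.
have mEE i j : measurable_fun setT (fun w => (\1_(E i `&` E j) w)%:E : \bar R).
  by apply/measurable_EFinP; apply: measurable_indic; exact: measurableI.
rewrite ge0_integralZl_EFin ?exprn_ge0 ?invr_ge0//; last 2 first.
- by move=> w _; do 2 (rewrite sume_ge0// => ? _); rewrite lee_fin.
- by do 2 (apply: emeasurable_sum => ?).
rewrite ge0_integral_sum//; last 2 first.
- by move=> i; apply: emeasurable_sum => j.
- by move=> i w _; rewrite sume_ge0// => j _; rewrite lee_fin.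
have PEij i j : P (E i `&` E j) = (q + (p - q) * (i == j)%:R)%:E.
  have [->|ij] := eqVneq i j; first by rewrite setIid PE mulr1 addrC subrK.
  by rewrite PEE// mulr0 addr0.
have -> : \sum_(i < M) \int[P]_w (\sum_(j < M) (\1_(E i `&` E j) w)%:E) =
    (\sum_(i < M) \sum_(j < M) (q + (p - q) * (i == j)%:R))%:E.
  rewrite -sumEFin; apply: eq_bigr => i _.
  rewrite ge0_integral_sum//.
  rewrite -sumEFin; apply: eq_bigr => j _.
  rewrite integral_indic ?setIT; [exact: PEij|by []|exact: measurableI].
rewrite -EFinM; congr EFin.
under eq_bigr => i _.
  rewrite big_split /= sumr_const card_ord -mulr_sumr (bigD1 i)//= eqxx big1.
    rewrite addr0 mulr1; over.
  by move=> j /negPf; rewrite eq_sym => ->.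
rewrite sumr_const card_ord -[((_ + _) *+ M)%R]mulr_natl -[(q *+ M)%R]mulr_natl.
by field; rewrite pnatr_eq0 -lt0n.
Qed.

Lemma integral_mean_indicB_sqr M c : (0 < M)%N ->
  \int[P]_w ((mean_indic M w - c) ^+ 2)%:E =
    (q - 2 * c * p + c ^+ 2 + (p - q) / M%:R)%:E.
Proof.
move=> M0; rewrite (integral_sqrB c _ _ (integral_mean_indic M0)
  (integral_mean_indic_sqr M0)).
- by congr EFin; ring.
- exact: measurable_mean_indic.
- by move=> w; rewrite ger0_norm ?mean_indic_ge0 ?mean_indic_le1.
Qed.

End second_moments.

(** * Replicate probabilities as moments of the conditional distribution function *)

Section conditional_moments.
Context {d dX : measure_display} {Omega : measurableType d}
  {XX : measurableType dX} {R : realType} (P : probability Omega R).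
Variables (X : {RV P >-> XX}) (Y : nat -> {RV P >-> R}) (K : R.-pker XX ~> R).
Hypotheses (Y_ci : cond_independent X Y)
  (Y_cid : cond_identically_distributed X Y)
  (K_rcd : is_regular_cond_dist X (Y 0%N) K).
Variable x : R.
Let E i := Y i @^-1` `]-oo, x]%classic.

Lemma ker_df_ge0 z : 0 <= ker_df K z x.
Proof. by rewrite fine_ge0. Qed.

Lemma ker_df_le1 z : ker_df K z x <= 1.
Proof.
have K1 : (K z setT <= 1)%E by rewrite prob_kernel.
rewrite /ker_df -lee_fin fineK; last exact: fin_num_le1.
by apply: le_trans K1; apply: le_measure; rewrite ?inE.
Qed.

Lemma measurable_ker_df : measurable_fun setT (fun z => ker_df K z x).
Proof.
by apply: measurableT_comp => //; exact: measurable_kernel.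
Qed.

Lemma integral_comp_RV (g : XX -> R) : measurable_fun setT g ->
  (forall z, 0 <= g z) ->
  (\int[P]_w (g (X w))%:E = \int[distribution P X]_z (g z)%:E)%E.
Proof.
move=> mg g0; rewrite ge0_integral_pushforward//.
- exact/measurable_EFinP.
- by move=> z _; rewrite lee_fin.
Qed.

Let cond_prob_integral (A : set Omega) g : is_cond_prob X A g ->
  (\int[distribution P X]_z (g z)%:E = P A)%E.
Proof. by move=> [_ /(_ setT measurableT)]; rewrite preimage_setT setIT. Qed.

(** [K] is given as conditional law of replicate 0; the common conditional law transfers it to every
    replicate. *)
Let condE i : is_cond_prob X (E i) (fun z => ker_df K z x).
Proof. by apply: (Y_cid (i := 0%N)) => //; exact: K_rcd. Qed.

Lemma prob_le_ker_df i : (P (E i) = \int[P]_w (ker_df K (X w) x)%:E)%E.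
Proof.
rewrite -(cond_prob_integral (condE i)); apply/esym.
apply: (@integral_comp_RV (fun z => ker_df K z x)); last exact: ker_df_ge0.
exact: measurable_ker_df.
Qed.

(** Conditional independence on the two-element set of indices makes the conditional probability of
    the intersection a product of two equal factors. *)
Lemma prob_le2_ker_df i j : i != j ->
  (P (E i `&` E j) = \int[P]_w (ker_df K (X w) x ^+ 2)%:E)%E.
Proof.
move=> ij; apply/esym.
rewrite [LHS](@integral_comp_RV (fun z => ker_df K z x ^+ 2)); last 2 first.
- by apply: measurable_funX; exact: measurable_ker_df.
- by move=> z; rewrite sqr_ge0.
have /cond_prob_integral := Y_ci [fset i; j]%fset (fun=> measurable_itv `]-oo, x])
  condE.
rewrite (_ : \bigcap_(k in [set` [fset i; j]%fset]) _ = E i `&` E j).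
  move=> <-; apply: eq_integral => z _.
  by rewrite big_fsetU1 ?inE//= big_seq_fset1 expr2.
apply/seteqP; split=> w /=.
  by move=> Ew; split; apply: Ew; rewrite /= !inE eqxx ?orbT.
by move=> [? ?] k /=; rewrite !inE => /orP[] /eqP ->.
Qed.

End conditional_moments.

(** * Integrals of products against tensor powers *)

Section tensor_integral.
Context {R : realType}.
Local Open Scope ereal_scope.

Lemma ge0_integral_tensorS (mu : probability R R) (m : nat)
    (f : m.+1.-tuple R -> \bar R) :
  measurable_fun setT f -> (forall t, 0 <= f t) ->
  \int[tensor_power mu m.+1]_t f t =
  \int[mu]_x \int[tensor_power mu m]_t f (cons_pair (x, t)).
Proof.
move=> mf f0 /=; rewrite ge0_integral_pushforward//.
rewrite preimage_setT fubini_tonelli1//.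
- by apply: measurableT_comp => //; exact: measurable_cons_pair.
- by move=> x; exact: f0.
Qed.

Lemma integral_tensor_cons (mu : probability R R) (m : nat)
    (k : m.+1.-tuple R -> R) (f : R -> R) (g : m.-tuple R -> R) :
  measurable_fun setT k -> measurable_fun setT f -> measurable_fun setT g ->
  (forall x, 0 <= f x)%R -> (forall t, 0 <= g t)%R ->
  (forall t, 0 <= k t)%R ->
  (forall x t, k (cons_pair (x, t)) = f x * g t)%R ->
  \int[tensor_power mu m.+1]_t (k t)%:E =
    (\int[mu]_x (f x)%:E) * \int[tensor_power mu m]_t (g t)%:E.
Proof.
move=> mk mf mg f0 g0 k0 kE.
rewrite ge0_integral_tensorS//; last exact/measurable_EFinP.
rewrite -ge0_integralZr//; last 3 first.
- exact/measurable_EFinP.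
- by move=> x _; rewrite lee_fin.
- by apply: integral_ge0 => t _; rewrite lee_fin.
apply: eq_integral => x _.
under eq_integral do rewrite kE EFinM.
rewrite ge0_integralZl_EFin//.
- by move=> t _; rewrite lee_fin.
- exact/measurable_EFinP.
Qed.

(** Coordinates are peeled off one at a time by Tonelli; coordinate 0, the place of the original
    statistic, contributes the factor 1. *)
Lemma integral_tensor3 (mu : probability R R) (f g : R -> R) :
  measurable_fun setT f -> measurable_fun setT g ->
  (forall x, 0 <= f x)%R -> (forall x, 0 <= g x)%R ->
  \int[tensor_power mu 3]_t (f (tnth t (inord 1)) * g (tnth t (inord 2)))%:E =
  (\int[mu]_x (f x)%:E) * (\int[mu]_x (g x)%:E).
Proof.
move=> mf mg f0 g0.
have mtnth m (i : 'I_m) (k : R -> R) : measurable_fun setT k ->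
    measurable_fun setT (fun t : m.-tuple R => k (tnth t i)).
  by move=> mk; apply: measurableT_comp => //; exact: measurable_tnth.
rewrite (@integral_tensor_cons mu 2 _ (cst 1%R)
    (fun t => f (tnth t ord0) * g (tnth t ord_max))%R)//; first last.
- move=> x t; rewrite mul1r; congr (f _ * g _)%R;
    by rewrite !(tnth_nth x) /= inordK.
- by move=> t; rewrite mulr_ge0.
- by move=> t; rewrite mulr_ge0.
- by apply: measurable_funM; exact: mtnth.
- by apply: measurable_funM; exact: mtnth.
have -> : \int[mu]_x (cst 1%R x)%:E = 1.
  by rewrite (integral_cst mu measurableT 1) mul1e; exact: probability_setT.
rewrite mul1e.
rewrite (@integral_tensor_cons mu 1 _ f (fun t => g (tnth t ord0)))//; first last.
- by move=> x t; congr (f _ * g _)%R; rewrite !(tnth_nth x).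
- by move=> t; rewrite mulr_ge0.
- exact: mtnth.
- by apply: measurable_funM; exact: mtnth.
congr *%E.
rewrite (@integral_tensor_cons mu 0 _ g (cst 1%R))//; first last.
- by move=> x t; rewrite mulr1; congr g; rewrite !(tnth_nth x).
- exact: mtnth.
have -> : \int[tensor_power mu 0]_t (cst 1%R t)%:E = 1.
  by rewrite (integral_cst (tensor_power mu 0) measurableT 1) mul1e; exact: probability_setT.
by rewrite mule1.
Qed.

End tensor_integral.

(** * From joint weak convergence to vanishing mean square deviation *)

Section joint_convergence.
Context {d : measure_display} {Omega : measurableType d} {R : realType}
  (P : probability Omega R) (nu : probability R R).
Variables (S_ : nat -> {RV P >-> R}) (Sb : nat -> nat -> {RV P >-> R}).
Hypothesis cvg3 : weak_cvg_tuple
  (fun n => distribution P (boot_tuple (S_ n) (Sb n) 2)) (tensor_power nu 3).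

Lemma joint_cvg_product (f g : R -> R) :
  continuous f -> continuous g ->
  (forall x, 0 <= f x <= 1) -> (forall x, 0 <= g x <= 1) ->
  (\int[P]_w (f (Sb n 0%N w) * g (Sb n 1%N w))%:E)%E @[n --> \oo] -->
  ((\int[nu]_x (f x)%:E) * (\int[nu]_x (g x)%:E))%E.
Proof.
move=> cf cg f01 g01.
have f0 x : 0 <= f x by case/andP: (f01 x).
have g0 x : 0 <= g x by case/andP: (g01 x).
have mf : measurable_fun setT f by exact: continuous_measurable_fun.
have mg : measurable_fun setT g by exact: continuous_measurable_fun.
pose k (u : 'rV[R]_3) := f (u ord0 (inord 1)) * g (u ord0 (inord 2)).
have ccoord (h : R -> R) i : continuous h ->
    continuous (fun u : 'rV[R]_3 => h (u ord0 i)).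
  move=> ch u; apply: (@continuous_comp _ _ _ (fun v : 'rV[R]_3 => v ord0 i) h).
    exact: coord_continuous.
  exact: ch.
have ck : continuous k.
  by move=> u; exact: (cvgM (ccoord f (inord 1) cf u) (ccoord g (inord 2) cg u)).
have bk : bounded_fun k.
  exists 1; split; rewrite ?num_real // => M M1 u _ /=; apply: le_trans (ltW M1).
  rewrite ger0_norm ?mulr_ge0// -[leRHS]mulr1.
  by apply: ler_pM => //; [case/andP: (f01 (u ord0 (inord 1)))|
    case/andP: (g01 (u ord0 (inord 2)))].
have := cvg3 ck bk.
have kE (t : 3.-tuple R) : k (\row_i tnth t i) =
    f (tnth t (inord 1)) * g (tnth t (inord 2)) by rewrite /k !mxE.
under [X in _ --> X]eq_integral do rewrite kE.
rewrite integral_tensor3//.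
(* Index shift: the statistic occupies position 0 of the tuple, so replicate [i] sits at position
   [i + 1]. *)
have bootE n w (i : 'I_2) : tnth (boot_tuple (S_ n) (Sb n) 2 w) (lift ord0 i) = Sb n i w.
  by rewrite tnthS tnth_mktuple.
have i1 : inord 1 = lift ord0 (ord0 : 'I_2) by apply: val_inj; rewrite /= inordK.
have i2 : inord 2 = lift ord0 (ord_max : 'I_2) by apply: val_inj; rewrite /= inordK.
have -> : (fun n => \int[distribution P (boot_tuple (S_ n) (Sb n) 2)]_t
      (k (\row_i tnth t i))%:E)%E =
    (fun n => \int[P]_w (f (Sb n 0%N w) * g (Sb n 1%N w))%:E)%E.
  apply/funext => n; under eq_integral do rewrite kE.
  rewrite ge0_integral_pushforward//; last 2 first.
  - apply/measurable_EFinP; apply: measurable_funM;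
      apply: measurableT_comp => //; exact: measurable_tnth.
  - by move=> t _; rewrite lee_fin mulr_ge0.
  rewrite preimage_setT; apply: eq_integral => w _ /=.
  by rewrite i1 i2 !bootE.
exact.
Qed.

(** An upper bound on the joint probability and a lower bound on the marginal one suffice. The first
    comes from the ramp starting at [x] in both factors, the second from the ramp ending at [x]. *)
Lemma joint_cvg_second_moment (x e : R) :
  let F y := fine (nu `]-oo, y]%classic) in
  continuous F -> 0 < e -> \forall n \near \oo,
  fine (P (Sb n 0%N @^-1` `]-oo, x]%classic `&` Sb n 1%N @^-1` `]-oo, x]%classic))
    - 2 * F x * fine (P (Sb n 0%N @^-1` `]-oo, x]%classic)) + F x ^+ 2 <= e.
Proof.
move=> F cF e0.
pose E n i := Sb n i @^-1` `]-oo, x]%classic.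
have mE n i : measurable (E n i).
  by rewrite -[E n i]setTI; exact: measurable_funPT.
have nu1 : (nu setT <= 1)%E by rewrite probability_setT.
have F0 y : 0 <= F y by rewrite fine_ge0.
have F1 y : F y <= 1.
  rewrite -lee_fin fineK; last exact: fin_num_le1.
  by apply: le_trans nu1; apply: le_measure; rewrite ?inE.
(* With [F x] abbreviated to F, the joint probability is at most (F + r)^2 + r and the marginal one
   at least F - 2r, so the expression is at most 6Fr + r^2 + r, hence at most 8r as F and r do not
   exceed 1. *)
pose r := Num.min (e / 8) 1.
have r0 : 0 < r by rewrite lt_min ltr01 divr_gt0.
have re : r <= e / 8 by rewrite ge_min lexx.
have r1 : r <= 1 by rewrite ge_min lexx orbT.
have [h h01 [_ Fh hF]] := continuous_bracket x cF r0.
have /andP[h0 h1] := h01.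
have rcont y : continuous (ramp y h) by apply: BL1_continuous; exact: BL1_ramp.
have r01 y z : 0 <= ramp y h z <= 1.
  by rewrite ramp_ge0//= (le_trans _ h1)// ge_min lexx.
have rfin y : (\int[nu]_z (ramp y h z)%:E)%E \is a fin_num.
  exact: fin_num_integral_ramp.
have Eind n i w : h * \1_(E n i) w = h * step x (Sb n i w).
  rewrite stepE indicE (_ : (w \in E n i) = (Sb n i w <= x))//.
  by apply/idP/idP; rewrite inE /E /= in_itv.
have mramp n i y : measurable_fun setT (fun w => ramp y h (Sb n i w)).
  by apply: (measurableT_comp (continuous_measurable_fun (rcont y))).
have le_step y z : h * step y z <= ramp y h z by exact: ramp_ge_step.
have hh0 : 0 < h ^+ 2 by rewrite exprn_gt0.
have q_near : \forall n \near \oo,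
    fine (P (E n 0%N `&` E n 1%N)) <= F (x + h) ^+ 2 + r.
  have := joint_cvg_product (rcont x) (rcont x) (r01 x) (r01 x).
  rewrite -(fineK (rfin x)) -EFinM => /fine_cvgP[fin_near].
  move=> /cvgrPdist_le /(_ _ (mulr_gt0 hh0 r0)) cvg_near.
  apply: filterS2 fin_near cvg_near => n fin_n /=; rewrite ler_norml => /andP[cn _].
  rewrite -(ler_pM2l hh0).
  have I1 : h ^+ 2 * fine (P (E n 0%N `&` E n 1%N)) <=
      fine (\int[P]_w (ramp x h (Sb n 0%N w) * ramp x h (Sb n 1%N w))%:E)%E.
    rewrite -lee_fin EFinM !fineK ?fin_num_measure//; last exact: measurableI.
    rewrite -[X in P X]setIT -integral_indic//; last exact: measurableI.
    rewrite -ge0_integralZl_EFin ?exprn_ge0 ?(ltW h0)//; last first.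
      by apply/measurable_EFinP; apply: measurable_indic; exact: measurableI.
    apply: ge0_le_integral => //.
    - by move=> w _; rewrite -EFinM lee_fin mulr_ge0// ltW.
    - by apply/measurable_EFinP; apply: measurable_funM => //;
        apply: measurable_indic; exact: measurableI.
    - by apply/measurable_EFinP; exact: measurable_funM.
    - move=> w _; rewrite -EFinM lee_fin indicI /= mulrACA !Eind.
      by apply: ler_pM; rewrite ?mulr_ge0 ?step_ge0 ?(ltW h0).
  have I2 : fine (\int[nu]_z (ramp x h z)%:E)%E <= h * F (x + h).
    exact: fine_integral_ramp_le.
  have I0 : 0 <= fine (\int[nu]_z (ramp x h z)%:E)%E.
    by rewrite fine_ge0// integral_ge0// => z _; rewrite lee_fin ramp_ge0.
  have I3 := ler_pM I0 I0 I2 I2.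
  nra.
have p_near : \forall n \near \oo, F (x - h) - r <= fine (P (E n 0%N)).
  (* Taking 1 as second factor extracts the marginal law of one replicate. *)
  have c1 : continuous (cst 1 : R -> R) by move=> ?; exact: cvg_cst.
  have := joint_cvg_product (rcont (x - h)) c1 (r01 (x - h)).
  rewrite -(fineK (rfin (x - h))).
  have -> : (\int[nu]_z (cst 1 z)%:E)%E = 1%E.
    by rewrite (integral_cst nu measurableT 1) mul1e; exact: probability_setT.
  rewrite mule1 => /(_ _) /fine_cvgP[|fin_near].
    by move=> z; rewrite /= ler01 lexx.
  move=> /cvgrPdist_le /(_ _ (mulr_gt0 h0 r0)) cvg_near.
  apply: filterS2 fin_near cvg_near => n fin_n /=; rewrite ler_norml => /andP[_ cn].
  rewrite -(ler_pM2l h0).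
  have I1 : fine (\int[P]_w (ramp (x - h) h (Sb n 0%N w) * 1)%:E)%E <=
      h * fine (P (E n 0%N)).
    rewrite -lee_fin EFinM !fineK ?fin_num_measure//.
    rewrite -[X in P X]setIT -integral_indic//.
    rewrite -ge0_integralZl_EFin ?(ltW h0)//; last first.
      by apply/measurable_EFinP; exact: measurable_indic.
    apply: ge0_le_integral => //.
    - by move=> w _; rewrite mulr1 lee_fin ramp_ge0.
    - by apply/measurable_EFinP; exact: measurable_funM.
    - by apply/measurable_EFinP; apply: measurable_funM => //; exact: measurable_indic.
    - move=> w _; rewrite -EFinM lee_fin mulr1 Eind.
      by have := ramp_le_step (x - h) (Sb n 0%N w) h0; rewrite subrK.
  have I2 : h * F (x - h) <= fine (\int[nu]_z (ramp (x - h) h z)%:E)%E.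
    exact: fine_integral_ramp_ge.
  lra.
apply: filterS2 q_near p_near => n.
have := F0 x; have := F1 x; have := F0 (x + h); have := F1 (x + h).
have := F0 (x - h).
rewrite /E; nra.
Qed.

End joint_convergence.

(** * The empirical measure of the replicates *)

Section empirical_measure.
Context {R : realType}.
Local Open Scope ereal_scope.

(** Same body as [empirical], with the measure structure kept in the type. *)
Definition empirical_measure (y : nat -> R) (M : nat) :
    {measure set R -> \bar R} :=
  mscale ((M%:R^-1 : R)%:nng)%R (msum (fun i => \d_(y i)) M).

Lemma empirical_measureE (y : nat -> R) M (B : set R) :
  empirical_measure y M B = (M%:R^-1 * \sum_(i < M) \1_B (y i))%:E.
Proof.
rewrite /empirical_measure /= /mscale /= /msum EFinM -sumEFin; congr *%E.
Qed.

(** Only an inequality, since the measure vanishes at [M = 0]; this is why the distance lemmas are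
    stated for total mass at most 1. *)
Lemma empirical_measure_le1 (y : nat -> R) M : empirical_measure y M setT <= 1.
Proof.
rewrite empirical_measureE lee_fin.
by apply: (mean_le1 (a := fun i => \1_setT (y i))) => i; rewrite indicE in_setT.
Qed.

Lemma emp_dfE (y : nat -> R) M x :
  emp_df y M x = fine (empirical_measure y M `]-oo, x]%classic).
Proof.
rewrite empirical_measureE /=; congr (_ * _)%R; apply: eq_bigr => i _.
by rewrite -stepE.
Qed.

Lemma measurable_empirical_measure d (Omega : measurableType d)
    (Y : nat -> Omega -> R) M (B : set R) :
  (forall i, measurable_fun setT (Y i)) -> measurable B ->
  measurable_fun setT (fun w => empirical_measure (Y ^~ w) M B).
Proof.
move=> mY mB; under eq_fun do rewrite empirical_measureE.
apply/measurable_EFinP; apply: measurable_funM => //; apply: measurable_sum => i.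
by apply: (measurableT_comp _ (mY i)); exact: measurable_indic.
Qed.

End empirical_measure.

(** * Measurability of the two distances for random measures *)

Section measurable_distances.
Context {R : realType} d (Omega : measurableType d).
Variables (mu : Omega -> {measure set R -> \bar R}) (q : {measure set R -> \bar R}).
Hypotheses (mmu : forall B, measurable B -> measurable_fun setT (mu ^~ B))
  (mu1 : forall w, (mu w setT <= 1)%E) (q1 : (q setT <= 1)%E).

Lemma measurable_dBL : measurable_fun setT (fun w => dBL (mu w) q).
Proof.
apply: (@measurable_ipm R _ Omega mu q BL1 BL1_seq mmu mu1 q1).
- exact: measurable_BL1.
- by move=> f [].
- by move=> n; exact: BL1_mcshane.
- exact: BL1_seq_dense.
Qed.

Lemma measurable_dK : measurable_fun setT (fun w => dK (mu w) q).
Proof.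
under eq_fun do rewrite dK_ipm.
apply: (@measurable_ipm R _ Omega mu q (range step) rat_step mmu mu1 q1).
- by move=> _ [x _ <-]; exact: measurable_step.
- by move=> _ [x _ <-]; exact: norm_step_le1.
- by move=> n; exists (ratr (odflt 0 (choice.unpickle n))).
- exact: rat_step_dense.
Qed.

End measurable_distances.

(** * Properties of the continuous limit distribution function *)

Section continuous_cdf.
Context {R : realType} {d : measure_display} {T : measurableType d}
  (P : probability T R) (S : {RV P >-> R}).
Hypothesis cS : continuous (cdf S).

Let F x := fine (cdf S x).

Let cdf_fin x : cdf S x \is a fin_num.
Proof. by rewrite fin_num_measure. Qed.

Lemma continuous_fine_cdf : continuous F.
Proof.
move=> x; apply: fine_cvg; rewrite fineK//; exact: cS.
Qed.

Lemma fine_cdf_nondecreasing : {homo F : a b / a <= b}.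
Proof. by move=> a b ab; rewrite fine_le// cdf_nondecreasing. Qed.

(** The limits 0 and 1 at the two infinities give points with values on either side of [u]; the
    intermediate value theorem does the rest. *)
Lemma fine_cdf_surj u : 0 < u < 1 -> exists x, F x = u.
Proof.
move=> /andP[u0 u1].
have [a Fa] : exists a, F a <= u.
  have /fine_cvg /cvgrPdist_le /(_ _ u0) := cvg_cdfNy0 S.
  move=> [a [_ aP]]; exists (a - 1).
  have := aP (a - 1); rewrite sub0r normrN => /(_ _); rewrite ltrBlDr ltrDl => /(_ ltr01).
  by apply: le_trans; exact: ler_norm.
have [b Fb] : exists b, u <= F b.
  have u10 : 0 < 1 - u by rewrite subr_gt0.
  have /fine_cvg /cvgrPdist_le /(_ _ u10) := cvg_cdfy1 S.
  move=> [b [_ bP]]; exists (b + 1).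
  have := bP (b + 1); rewrite ltrDl => /(_ ltr01); rewrite ler_norml /F /=.
  by move=> /andP[_]; lra.
have [ab|ba] := leP a b; last first.
  (* If [b < a], monotonicity gives [u <= F b <= F a <= u]. *)
  exists a; apply/eqP; rewrite eq_le Fa /=.
  by apply: (le_trans Fb); apply: fine_cdf_nondecreasing; exact: ltW.
have Fab : F a <= F b by exact: fine_cdf_nondecreasing.
have [||c _ <-] := @IVT R F a b u ab; last by exists c.
  by apply: continuous_subspaceT; exact: continuous_fine_cdf.
by rewrite min_l// max_r// Fa Fb.
Qed.

End continuous_cdf.

(** * Mean square deviations of the conditional and empirical distribution functions *)

Section bootstrap_moments.
Context {R : realType} {d : measure_display} {Omega : measurableType d}
  (P : probability Omega R) {dX : measure_display} {XX : measurableType dX}.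
Variables (X : {RV P >-> XX}) (Y : nat -> {RV P >-> R}) (K : R.-pker XX ~> R).
Hypotheses (Y_ci : cond_independent X Y)
  (Y_cid : cond_identically_distributed X Y)
  (K_rcd : is_regular_cond_dist X (Y 0%N) K).
Variables (x c : R).
Hypothesis c01 : 0 <= c <= 1.

Let E i := Y i @^-1` `]-oo, x]%classic.
Let p := fine (P (E 0%N)).
Let q := fine (P (E 0%N `&` E 1%N)).

Let mE i : measurable (E i).
Proof. by rewrite -[E i]setTI; exact: measurable_funPT. Qed.

(* The mean square of F_n(x) - c, see integral_ker_dfB_sqr. *)
Definition replicate_sqr_dev : R := q - 2 * c * p + c ^+ 2.

Let PE i : P (E i) = p%:E.
Proof.
by rewrite /p fineK ?fin_num_measure// !(prob_le_ker_df Y_cid K_rcd).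
Qed.

Let PEE i j : i != j -> P (E i `&` E j) = q%:E.
Proof.
move=> ij; rewrite /q fineK; last by rewrite fin_num_measure//; exact: measurableI.
by rewrite !(prob_le2_ker_df Y_ci Y_cid K_rcd).
Qed.

Lemma measurable_ker_df_RV : measurable_fun setT (fun w => ker_df K (X w) x).
Proof. by apply: (measurableT_comp (measurable_ker_df K x)). Qed.

Lemma norm_ker_dfB z : `|ker_df K z x - c| <= 1.
Proof.
have := ker_df_ge0 K x z; have := ker_df_le1 K x z; move: c01 => /andP[? ?] ? ?.
by rewrite ler_norml; apply/andP; split; lra.
Qed.

Lemma integral_ker_dfB_sqr :
  (\int[P]_w ((ker_df K (X w) x - c) ^+ 2)%:E = replicate_sqr_dev%:E)%E.
Proof.
apply: integral_sqrB.
- exact: measurable_ker_df_RV.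
- by move=> w; rewrite ger0_norm ?ker_df_ge0 ?ker_df_le1.
- by rewrite -(prob_le_ker_df Y_cid K_rcd x 0%N) PE.
- by rewrite -(prob_le2_ker_df Y_ci Y_cid K_rcd x (i := 0%N) (j := 1%N))// PEE.
Qed.

Lemma emp_df_mean_indic M w : emp_df (fun i => Y i w) M x = mean_indic E M w.
Proof.
rewrite /emp_df /mean_indic; congr (_ * _); apply: eq_bigr => i _.
rewrite indicE (_ : (w \in E i) = (Y i w <= x))//.
by apply/idP/idP; rewrite inE /E /= in_itv.
Qed.

Lemma measurable_emp_df M :
  measurable_fun setT (fun w => emp_df (fun i => Y i w) M x).
Proof.
by under eq_fun do rewrite emp_df_mean_indic; exact: measurable_mean_indic.
Qed.

Lemma norm_emp_dfB M w : `|emp_df (fun i => Y i w) M x - c| <= 1.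
Proof.
rewrite emp_df_mean_indic.
have := @mean_indic_ge0 R _ _ E M w; have := @mean_indic_le1 R _ _ E M w.
by move: c01 => /andP[? ?] ? ?; rewrite ler_norml; apply/andP; split; lra.
Qed.

Lemma integral_emp_dfB_sqr M : (0 < M)%N ->
  (\int[P]_w ((emp_df (fun i => Y i w) M x - c) ^+ 2)%:E =
    (replicate_sqr_dev + (p - q) / M%:R)%:E)%E.
Proof.
move=> M0; under eq_integral do rewrite emp_df_mean_indic.
exact: integral_mean_indicB_sqr.
Qed.

Let q_le_p : q <= p.
Proof.
rewrite fine_le ?fin_num_measure//; first exact: measurableI.
by apply: le_measure; rewrite ?inE//; exact: measurableI.
Qed.

(** The excess [(p - q) / M] is nonnegative because [q] is the probability of a smaller event. This
    bound recovers the conditional statement from the empirical one. *)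
Lemma integral_emp_dfB_sqr_ge M : (0 < M)%N ->
  (replicate_sqr_dev%:E <=
    \int[P]_w ((emp_df (fun i => Y i w) M x - c) ^+ 2)%:E)%E.
Proof.
by move=> M0; rewrite integral_emp_dfB_sqr// lee_fin lerDl divr_ge0 ?subr_ge0.
Qed.

Lemma integral_emp_dfB_sqr_le M : (0 < M)%N ->
  (\int[P]_w ((emp_df (fun i => Y i w) M x - c) ^+ 2)%:E <=
    (replicate_sqr_dev + M%:R^-1)%:E)%E.
Proof.
move=> M0; rewrite integral_emp_dfB_sqr// lee_fin lerD2l ler_piMl ?invr_ge0//.
have p1 : p <= 1 by rewrite -lee_fin fineK ?fin_num_measure ?probability_le1.
have q0 : 0 <= q by rewrite fine_ge0.
lra.
Qed.

End bootstrap_moments.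

(** * Equivalence of conditional and empirical pointwise convergence *)

Section equivalence.
Context {R : realType} {d : measure_display} {Omega : measurableType d}
  (P : probability Omega R)
  {dX : nat -> measure_display} {XX : forall n, measurableType (dX n)}.
Variables (X : forall n, {RV P >-> XX n}) (Sb : nat -> nat -> {RV P >-> R})
  (K : forall n, R.-pker (XX n) ~> R).
Hypotheses (Sb_ci : forall n, cond_independent (X n) (Sb n))
  (Sb_cid : forall n, cond_identically_distributed (X n) (Sb n))
  (K_rcd : forall n, is_regular_cond_dist (X n) (Sb n 0%N) (K n)).
Variables (x c : R).
Hypothesis c01 : 0 <= c <= 1.

(** The pivot between the two modes of convergence, involving neither [K] nor [M]. An upper bound is
    enough, the quantity being a mean square. *)
Definition sqr_dev_cvg0 := forall e : R, 0 < e ->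
  \forall n \near \oo, replicate_sqr_dev (Sb n) x c <= e.

Lemma ker_df_cvg_prob_sqr :
  cvg_prob0 P \oo (fun n w => ker_df (K n) (X n w) x - c) -> sqr_dev_cvg0.
Proof.
move=> /cvg_prob0_sqr H e e0.
have mK n : measurable_fun setT (fun w => ker_df (K n) (X n w) x - c).
  by apply: measurable_funB => //; exact: measurable_ker_df_RV.
have := H mK (fun n w => norm_ker_dfB (K n) x c01 (X n w)) e e0.
apply: filterS => n.
by rewrite (integral_ker_dfB_sqr (@Sb_ci n) (@Sb_cid n) (@K_rcd n)) lee_fin.
Qed.

Lemma sqr_ker_df_cvg_prob :
  sqr_dev_cvg0 -> cvg_prob0 P \oo (fun n w => ker_df (K n) (X n w) x - c).
Proof.
move=> H; apply: sqr_cvg_prob0 => [n|e e0].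
  by apply: measurable_funB => //; exact: measurable_ker_df_RV.
apply: filterS (H e e0) => n.
by rewrite (integral_ker_dfB_sqr (@Sb_ci n) (@Sb_cid n) (@K_rcd n)) lee_fin.
Qed.

Lemma emp_df_cvg_prob_sqr :
  cvg_prob0 P (filter_prod \oo \oo)
    (fun (i : nat * nat) w => emp_df (fun k => Sb i.1 k w) i.2 x - c) ->
  sqr_dev_cvg0.
Proof.
move=> /cvg_prob0_sqr H e e0.
have mE (i : nat * nat) :
    measurable_fun setT (fun w => emp_df (fun k => Sb i.1 k w) i.2 x - c).
  by apply: measurable_funB => //; exact: measurable_emp_df.
have := H mE (fun i w => norm_emp_dfB (Sb i.1) x c01 i.2 w) e e0.
move=> [[A B] [/= nearA [N _ NB]] AB]; apply: filterS nearA => n An.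
(* A single large [M] suffices for each [n], since the mean square at every positive [M] dominates
   the deviation; [N.+1] is positive. *)
have := AB (n, N.+1) (conj An (NB N.+1 (leqnSn N))) => /=.
rewrite -lee_fin; apply: le_trans.
exact: (integral_emp_dfB_sqr_ge (@Sb_ci n) (@Sb_cid n) (@K_rcd n)).
Qed.

Lemma sqr_emp_df_cvg_prob : sqr_dev_cvg0 ->
  cvg_prob0 P (filter_prod \oo \oo)
    (fun (i : nat * nat) w => emp_df (fun k => Sb i.1 k w) i.2 x - c).
Proof.
move=> H; apply: sqr_cvg_prob0 => [i|e e0].
  by apply: measurable_funB => //; exact: measurable_emp_df.
have e20 : 0 < e / 2 by rewrite divr_gt0.
exists ([set n | replicate_sqr_dev (Sb n) x c <= e / 2],
  [set M | (0 < M)%N /\ M%:R^-1 <= e / 2]).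
  split => /=; first exact: H.
  have nearM := near_infty_natSinv_lt (PosNum e20).
  (* The bound in [NM] concerns the inverse of a successor, so the threshold is shifted by one,
     which also makes [M] positive. *)
  case: nearM => N _ NM; exists N.+1 => //= M NltM.
  case: M NltM => // M NM1; split => //; apply/ltW/NM; exact: NM1.
move=> [n M] /= [vn [M0 Me]] /=.
apply: (@le_trans _ _ (replicate_sqr_dev (Sb n) x c + M%:R^-1)%:E).
  exact: (integral_emp_dfB_sqr_le (@Sb_ci n) (@Sb_cid n) (@K_rcd n)).
by rewrite lee_fin [leRHS]splitr lerD.
Qed.

End equivalence.

(** * From any consistency assertion to the four exceedance limits *)

Theorem lemma4p2 (R : realType)
  (d : measure_display) (Omega : measurableType d) (P : probability Omega R)
  (dX : nat -> measure_display) (XX : forall n : nat, measurableType (dX n))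
  (X : forall n : nat, {RV P >-> XX n})
  (s : forall n : nat, {mfun XX n >-> R})
  (S_ : nat -> {RV P >-> R})
  (S_E : forall (n : nat) (w : Omega), S_ n w = s n (X n w))
  (dW : nat -> measure_display) (WW : forall n : nat, measurableType (dW n))
  (W : forall n : nat, nat -> {RV P >-> WW n})
  (W_id : forall n : nat, identically_distributed (W n))
  (sb : forall n : nat, nat -> {mfun (XX n * WW n)%type >-> R})
  (Sb : nat -> nat -> {RV P >-> R})
  (Sb_E : forall (n i : nat) (w : Omega), Sb n i w = sb n i (X n w, W n i w))
  (Sb_ci : forall n : nat, cond_independent (X n) (Sb n))
  (Sb_cid : forall n : nat, cond_identically_distributed (X n) (Sb n))
  (K : forall n : nat, R.-pker (XX n) ~> R)
  (K_rcd : forall n : nat, is_regular_cond_dist (X n) (Sb n 0%N) (K n))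
  (dS : measure_display) (OmegaS : measurableType dS)
  (PS : probability OmegaS R) (S : {RV PS >-> R})
  (S_cont : continuous (cdf S))
  (S_cvg : weak_cvg (fun n : nat => distribution P (S_ n)) (distribution PS S))
  (consistent : consistency_a S_ Sb S \/ consistency_b S_ Sb S \/
                consistency_c S_ X K \/ consistency_d S_ Sb \/
                consistency_e S_ X K \/ consistency_f S_ Sb) :
  forall alpha : R, 0 < alpha < 1 ->
  [/\ P [set w | gen_inv (ker_df (K n) (X n w)) (1 - alpha) <= S_ n w]
        @[n --> \oo] --> alpha%:E,
      P [set w | gen_inv (emp_df (fun i => Sb p.1 i w) p.2) (1 - alpha)
                   <= S_ p.1 w]
        @[p --> filter_prod \oo \oo] --> alpha%:E,
      P [set w | gen_inv (ker_df (K n) (X n w)) (1 - alpha) < S_ n w]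
        @[n --> \oo] --> alpha%:E &
      P [set w | gen_inv (emp_df (fun i => Sb p.1 i w) p.2) (1 - alpha)
                   < S_ p.1 w]
        @[p --> filter_prod \oo \oo] --> alpha%:E ].
Proof.
pose q n : {measure set R -> \bar R} := distribution P (S_ n).
pose F y := fine (cdf S y).
have cF : continuous F by exact: continuous_fine_cdf.
have q1 n : (q n setT <= 1)%E.
  exact: (@probability_le1 _ _ _ (distribution P (S_ n)) setT measurableT).
have nu1 : (distribution PS S setT <= 1)%E by exact: probability_le1.
have F01 y : 0 <= F y <= 1.
  rewrite fine_ge0//= -lee_fin fineK; first exact: cdf_le1.
  by rewrite fin_num_measure.
have qF y : fine (q n `]-oo, y]%classic) @[n --> \oo] --> F y.
  exact: (@weak_cvg_cdf _ q (distribution PS S)).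
pose muK n w : {measure set R -> \bar R} := K n (X n w).
have muK1 n w : (muK n w setT <= 1)%E by rewrite /muK prob_kernel.
have mmuK n B : measurable B -> measurable_fun setT (muK n ^~ B).
  by move=> mB; apply: (measurableT_comp (measurable_kernel (K n) B mB)).
pose muE (i : nat * nat) w := empirical_measure (fun k => Sb i.1 k w) i.2.
have muE1 i w : (muE i w setT <= 1)%E by exact: empirical_measure_le1.
have mmuE i B : measurable B -> measurable_fun setT (muE i ^~ B).
  by move=> mB; exact: measurable_empirical_measure.
have cvg1 : fst @ filter_prod (\oo : set_system nat) (\oo : set_system nat) --> \oo.
  exact: cvg_fst.
have emp_dev y : cvg_prob0 P (filter_prod \oo \oo)
      (fun i w => fine (muE i w `]-oo, y]%classic) - F y) ->
    sqr_dev_cvg0 Sb y (F y).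
  move=> H; apply: (emp_df_cvg_prob_sqr Sb_ci Sb_cid K_rcd (F01 y)) => e e0.
  have := H e e0.
  by under [X in X @ _ --> _]eq_fun do under eq_set do rewrite -emp_dfE.
(* All six assertions are brought to this one condition: (a) and (b) through two replicates, (c) and
   (e) through [K], (d) and (f) through the empirical measure. *)
have dev y : sqr_dev_cvg0 Sb y (F y).
  have joint : joint_weak_cvg S_ Sb S 2 -> sqr_dev_cvg0 Sb y (F y).
    by move=> H e e0; exact: (joint_cvg_second_moment H).
  case: consistent => [|[|[|[|[]]]]] H.
  - exact: joint.
  - exact: joint (H 2 _).
  - apply: (ker_df_cvg_prob_sqr Sb_ci Sb_cid K_rcd (F01 y)).
    apply: (@levy_cvg_prob _ _ _ P _ \oo id dBL muK q F) => // [|n].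
      exact: levy_control_dBL.
    by apply: measurable_dBL => // B; exact: mmuK.
  - apply: emp_dev.
    apply: (@levy_cvg_prob _ _ _ P _ _ fst dBL muE q F) => // [|i].
      exact: levy_control_dBL.
    by apply: measurable_dBL => // B; exact: mmuE.
  - apply: (ker_df_cvg_prob_sqr Sb_ci Sb_cid K_rcd (F01 y)).
    apply: (@levy_cvg_prob _ _ _ P _ \oo id dK muK q F) => // [|n].
      exact: levy_control_dK.
    by apply: measurable_dK => // B; exact: mmuK.
  - apply: emp_dev.
    apply: (@levy_cvg_prob _ _ _ P _ _ fst dK muE q F) => // [|i].
      exact: levy_control_dK.
    by apply: measurable_dK => // B; exact: mmuE.
move=> alpha alpha01.
have ndK n w : {homo ker_df (K n) (X n w) : a b / a <= b}.
  move=> a b ab; have K_fin y : K n (X n w) `]-oo, y]%classic \is a fin_num.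
    by apply: fin_num_le1 => //; exact: (muK1 n w).
  rewrite fine_le//.
  by apply: le_measure; rewrite ?inE//; exact: subitvPr.
have ndE (i : nat * nat) w : {homo emp_df (fun k => Sb i.1 k w) i.2 : a b / a <= b}.
  move=> a b ab; rewrite ler_wpM2l ?invr_ge0//; apply: ler_sum => k _.
  by rewrite ler_nat; case: leP => // ka; rewrite (le_trans ka ab).
have mK n y : measurable_fun setT (fun w => ker_df (K n) (X n w) y).
  exact: measurable_ker_df_RV.
have mE (i : nat * nat) y :
    measurable_fun setT (fun w => emp_df (fun k => Sb i.1 k w) i.2 y).
  exact: measurable_emp_df.
have mgK n : measurable_fun setT (fun w => gen_inv (ker_df (K n) (X n w)) (1 - alpha)).
  exact: measurable_gen_inv.
have mgE (i : nat * nat) : measurable_fun setT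
    (fun w => gen_inv (emp_df (fun k => Sb i.1 k w) i.2) (1 - alpha)).
  by apply: (@measurable_gen_inv _ _ _ (fun w => emp_df (fun k => Sb i.1 k w) i.2)).
have ndF : {homo F : a b / a <= b} by exact: fine_cdf_nondecreasing.
have surjF : forall u, 0 < u < 1 -> exists x, F x = u by exact: fine_cdf_surj.
have K_cvg y := sqr_ker_df_cvg_prob Sb_ci Sb_cid K_rcd (dev y).
have E_cvg y := sqr_emp_df_cvg_prob Sb_ci Sb_cid K_rcd (dev y).
have SF y : fine (P [set w | S_ n w <= y]) @[n --> \oo] --> F y.
  exact: qF.
(* The limit in [n] is pulled back along the first projection of the index pairs. *)
have SF2 y : fine (P [set w | S_ i.1 w <= y])
    @[i --> filter_prod (\oo : set_system nat) (\oo : set_system nat)] --> F y.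
  exact: (cvg_comp _ _ cvg1 (SF y)).
have mS n : measurable_fun setT (S_ n) by exact: measurable_funPT.
split.
- apply: (quantile_events (G := fun n w => ker_df (K n) (X n w)) (S := S_) (F := F)) => //.
  + by move=> n; exact: measurable_set_le.
  + by move=> n w /ltW.
- apply: (quantile_events (G := fun i w => emp_df (fun k => Sb i.1 k w) i.2)
    (S := fun i => S_ i.1) (F := F)) => //.
  + by move=> i; exact: measurable_set_le.
  + by move=> i w /ltW.
- apply: (quantile_events (G := fun n w => ker_df (K n) (X n w)) (S := S_) (F := F)) => //.
  + by move=> n; exact: measurable_set_lt.
  + by move=> n w /ltW.
- apply: (quantile_events (G := fun i w => emp_df (fun k => Sb i.1 k w) i.2)
    (S := fun i => S_ i.1) (F := F)) => //.
  + by move=> i; exact: measurable_set_lt.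
  + by move=> i w /ltW.
Qed.
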